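(* Let $T>0$, let $X$ be a uniformly convex complex Banach space, let $D\subset X$ be a linear subspace and let $\omega\in\mathbb{R}$. For each $t\in[0,T]$ let $A(t):D\subset X\to X$ be the generator of a strongly continuous group $(e^{A(t)s})_{s\in\mathbb{R}}$ on $X$ with $$\|e^{A(t)s}\|\leq e^{\omega|s|},\qquad s\in\mathbb{R},$$ where $\omega$ and the domain $D$ are independent of $t$. Let $Y$ be the space $D$ endowed with the graph norm of $A(0)$, and suppose that the map $[0,T]\ni t\mapsto A(t)\in\mathscr{L}(Y,X)$ is continuous and of bounded variation with respect to the operator norm of $\mathscr{L}(Y,X)$. Then there exists a unique evolution system $U(t,s)$ for $A(t)$ on $D$.
   Context: $\mathscr{L}(Y,X)$ denotes the bounded linear operators from $Y$ to $X$ with the operator norm, and $\mathscr{L}(X)=\mathscr{L}(X,X)$. A Banach space $X$ is uniformly convex if for every $\varepsilon>0$ there exists $\delta>0$ such that any normalized vectors $x,y\in X$ with $\|(x+y)/2\|>1-\delta$ satisfy $\|x-y\|<\varepsilon$. Definition (evolution system for $A(t)$ on $D$). Let $A(t):D\subset X\to X$, $t\in[0,T]$, be a family of closed linear operators with a time-independent dense domain $D$. A two-parameter family of operators $U(t,s)\in\mathscr{L}(X)$, $s,t\in[0,T]$ (defined on the whole square $[0,T]\times[0,T]$), is an evolution system for $A(t)$ on $D$ if: (i) $U(t,s)D\subset D$ for all $s,t\in[0,T]$, and for every $y\in D$ and $s\in[0,T]$ the map $t\mapsto x(t)=U(t,s)y$ on $[0,T]$ is a continuously differentiable (in the norm of $X$)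 solution of $\dot x(t)=A(t)x(t)$, $x(s)=y$; (ii) $U(s,s)=1$ and $U(t,r)U(r,s)=U(t,s)$ for all $s,r,t\in[0,T]$; (iii) $(t,s)\mapsto U(t,s)$ is strongly continuous on $[0,T]\times[0,T]$. *)

(* Defs.v *)
From HB Require Import structures.
From mathcomp Require Import all_boot all_order all_algebra.
From mathcomp Require Import complex.
From mathcomp Require Import all_classical all_reals all_analysis.

Set Implicit Arguments.
Unset Strict Implicit.
Unset Printing Implicit Defensive.

Import Order.TTheory GRing.Theory Num.Theory.
Import numFieldNormedType.Exports.

Local Open Scope classical_set_scope.
Local Open Scope ring_scope.

(* In a normed module over R[i] the norm takes its values in R[i] (they are
   nonnegative reals there); [rnorm] is the same norm with values in R. *)
Definition rnorm (R : realType) (X : normedModType R[i]) (x : X) : R :=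
  complex.Re `|x|.

Definition uniformly_convex (R : realType) (X : normedModType R[i]) : Prop :=
  forall eps : R, 0 < eps ->
  exists2 delta : R, 0 < delta &
    forall x y : X, rnorm x = 1 -> rnorm y = 1 ->
      1 - delta < rnorm (2^-1 *: (x + y)) -> rnorm (x - y) < eps.

(* An operator with domain D is a total function X -> X of which only the
   values on D matter.  The next two definitions treat it as a map from the
   normed space (D, n) to X; D = setT and n = rnorm gives the operators on X.
   The operator norm is extended-real valued, +oo meaning unbounded. *)
Definition opnorm (R : realType) (X : normedModType R[i])
    (D : set X) (n : X -> R) (B : X -> X) : \bar R :=
  ereal_sup [set (rnorm (B y))%:E | y in [set y | D y /\ n y <= 1]].

Definition bounded_operator (R : realType) (X : normedModType R[i])
    (D : set X) (n : X -> R) (B : X -> X) : Prop :=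
  (forall (a : R[i]) (x y : X), D x -> D y ->
     B (a *: x + y) = a *: B x + B y) /\
  (opnorm D n B < +oo)%E.

Definition graph_norm (R : realType) (X : normedModType R[i])
    (A : X -> X) (y : X) : R := rnorm y + rnorm (A y).

Definition strongly_continuous_group (R : realType) (X : normedModType R[i])
    (G : R -> X -> X) : Prop :=
  [/\ forall s : R, bounded_operator setT (@rnorm R X) (G s),
      forall x, G 0 x = x,
      forall s t x, G (s + t) x = G s (G t x) &
      forall x, continuous (fun s : R => G s x)].

(* The operator A with domain exactly D is the infinitesimal generator of G. *)
Definition is_generator (R : realType) (X : normedModType R[i])
    (D : set X) (A : X -> X) (G : R -> X -> X) : Prop :=
  let quotient x (h : R) : X := (h^-1)%:C%C *: (G h x - x) in
  (forall x, D x <-> exists v : X, quotient x h @[h --> 0^'] --> v) /\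
  (forall x, D x -> quotient x h @[h --> 0^'] --> A x).

(* One-sided at the endpoints 0 and T. *)
Definition has_derivative_on (R : realType) (X : normedModType R[i])
    (T : R) (x dx : R -> X) : Prop :=
  forall t : R, t \in `[0, T] ->
    ((s - t)^-1)%:C%C *: (x s - x t) @[s --> within `[0, T] t^'] --> dx t.

Definition opnorm_continuous (R : realType) (X : normedModType R[i])
    (D : set X) (n : X -> R) (T : R) (A : R -> X -> X) : Prop :=
  forall t : R, t \in `[0, T] ->
    opnorm D n (A s \- A t) @[s --> within `[0, T] (nbhs t)] --> 0%E.

(* [0 :: s] ranges over the partitions 0 = s_0 < s_1 < ... < s_k = T. *)
Definition opnorm_bounded_variation (R : realType) (X : normedModType R[i])
    (D : set X) (n : X -> R) (T : R) (A : R -> X -> X) : Prop :=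
  let jump (s : seq R) (i : nat) : \bar R :=
    opnorm D n (A (nth T (0 :: s) i.+1) \- A (nth T (0 :: s) i)) in
  exists M : R, forall s : seq R, itv_partition 0 T s ->
    (\sum_(0 <= i < size s) jump s i <= M%:E)%E.

(* Only the values of U on the square [0, T] x [0, T] matter. *)
Definition evolution_system (R : realType) (X : normedModType R[i])
    (T : R) (D : set X) (A : R -> X -> X) (U : R -> R -> X -> X) : Prop :=
  [/\ forall t s : R, t \in `[0, T] -> s \in `[0, T] ->
        bounded_operator setT (@rnorm R X) (U t s),
      forall (y : X) (s : R), D y -> s \in `[0, T] ->
        let x (t : R) := U t s y in
        [/\ forall t : R, t \in `[0, T] -> D (x t),
            has_derivative_on T x (fun t => A t (x t)),
            {within `[0, T], continuous (fun t : R => A t (x t))} &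
            x s = y],
      forall (s : R) (x : X), s \in `[0, T] -> U s s x = x,
      forall (s r t : R) (x : X), s \in `[0, T] -> r \in `[0, T] -> t \in `[0, T] ->
        U t r (U r s x) = U t s x &
      forall x, {within `[0, T] `*` `[0, T],
                  continuous (fun p : R * R => U p.1 p.2 x)}].

(* Main.v *)
(* Freeze A on the dyadic cells of [0, T]; the frozen problem is solved by products
   of the exponentials of the frozen generators.  Let n_a be the graph norm of A a.
   Since A is continuous and of bounded variation, there is a continuous
   nondecreasing v with |(A a - A b) y| <= |v a - v b| n_c(y) for all a, b, c (that
   n_0 <= C n_c is a closed graph argument).  Hence n_a <= exp |v a - v b| n_b, so
   the products are bounded in X and in the graph norms, and halving the cells
   changes them on D by at most a constant times (mesh) * (variation); they converge
   to a family U(t,s), which inherits the cocycle identity.  Uniform convexity is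
   used twice, in place of reflexivity and of weak convergence: a sequence converging
   in X with bounded graph norm has its limit in D, so U(t,s) maps D to D; and
   n_t(U(t,s)y) <= exp(|omega||t-s| + |v t - v s|) n_s(y) implies that
   t |-> A(t)U(t,s)y is continuous.  Uniqueness is a Gronwall estimate: near t a
   solution x differs from the orbit of x(t) under exp(A(t) s) by o(s). *)
Require Import Defs.
From HB Require Import structures.
From mathcomp Require Import all_boot all_order all_algebra.
From mathcomp Require Import complex.
From mathcomp Require Import all_classical all_reals all_analysis.
From mathcomp Require Import ring lra.

Set Implicit Arguments.
Unset Strict Implicit.
Unset Printing Implicit Defensive.

Import Order.TTheory GRing.Theory Num.Theory.
Import numFieldNormedType.Exports.

Local Open Scope classical_set_scope.
Local Open Scope ring_scope.

(** * The real-valued norm of X *)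

(** What shapes the proof is the sharp graph norm estimate. Continuity of A(t)U(t,s)y requires
    limsup n_t0(U(t,t0)y) <= n_t0(y) as t -> t0, and a bound with a constant factor in front is
    useless for that. This is why |A a - A b| is controlled in every graph norm n_c at once: each
    change of norm then costs just the exponential of an increment of [v], and the increments
    telescope along the product. Freezing at left endpoints spoils the telescoping in a single cell,
    and continuity of [v] makes that cell harmless in the limit. Integrals of orbits are replaced by
    dyadic means, whose identities are purely algebraic. The difference quotients along h = 2^-n
    play the role of a resolvent: they are bounded operators that converge to the generator on D. *)

Section AbelianGroupIdentities.
Variable V : zmodType.

(** Syntax for a reflective decision procedure: the value of an abelian group term is determined by
    the integer coefficients of its atoms, which [zcoef] computes. *)
Inductive zexpr := ZVar of nat | ZZero | ZAdd of zexpr & zexpr | ZOpp of zexpr.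

Fixpoint zeval (env : seq V) (e : zexpr) : V :=
  match e with
  | ZVar i => env`_i
  | ZZero => 0
  | ZAdd e1 e2 => zeval env e1 + zeval env e2
  | ZOpp e1 => - zeval env e1
  end.

Fixpoint zcoef (e : zexpr) (i : nat) : int :=
  match e with
  | ZVar j => (i == j)%:Z
  | ZZero => 0
  | ZAdd e1 e2 => zcoef e1 i + zcoef e2 i
  | ZOpp e1 => - zcoef e1 i
  end.

Lemma zevalE env e : zeval env e = \sum_(i < size env) env`_i *~ zcoef e i.
Proof.
elim: e => [j||e1 IH1 e2 IH2|e IH] /=; rewrite ?IH1 ?IH2 ?IH.
- have [js|js] := ltnP j (size env).
    rewrite (bigD1 (Ordinal js))//= eqxx mulr1z big1 ?addr0// => i ij.
    by rewrite (_ : (i == j :> nat) = false) ?mulr0z//; exact: negbTE.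
  rewrite nth_default// big1// => i _; have := ltn_ord i.
  by move=> /leq_trans/(_ js); rewrite ltn_neqAle => /andP[/negbTE ->]; rewrite mulr0z.
- by rewrite big1// => i _; rewrite mulr0z.
- by rewrite -big_split; apply: eq_bigr => i _; rewrite mulrzDr.
- by rewrite -sumrN; apply: eq_bigr => i _; rewrite mulrNz.
Qed.

Lemma zeval_eq env e1 e2 :
  all (fun i => zcoef e1 i == zcoef e2 i) (iota 0 (size env)) ->
  zeval env e1 = zeval env e2.
Proof.
move=> /allP h; rewrite !zevalE; apply: eq_bigr => i _.
by rewrite (eqP (h i _))// mem_iota ltn_ord.
Qed.

End AbelianGroupIdentities.

(* Up to conversion: equal atoms may carry different structure inferences. *)
Ltac zmod_same x y := match goal with _ => unify x y end.
Ltac zmod_index x l :=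
  match l with
  | cons ?y _ => let _ := zmod_same x y in constr:(O)
  | cons _ ?t => let n := zmod_index x t in constr:(S n)
  end.
Ltac zmod_mem x l :=
  match l with
  | nil => constr:(false)
  | cons ?y _ => let _ := zmod_same x y in constr:(true)
  | cons _ ?t => zmod_mem x t
  end.
Ltac zmod_atoms e l :=
  lazymatch e with
  | ?a + ?b => let l1 := zmod_atoms a l in zmod_atoms b l1
  | - ?a => zmod_atoms a l
  | 0 => l
  | ?x => lazymatch zmod_mem x l with true => l | false => constr:(cons x l) end
  end.
Ltac zmod_reify e l :=
  lazymatch e with
  | ?a + ?b => let a' := zmod_reify a l in let b' := zmod_reify b l in
      constr:(ZAdd a' b')
  | - ?a => let a' := zmod_reify a l in constr:(ZOpp a')
  | 0 => constr:(ZZero)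
  | ?x => let n := zmod_index x l in constr:(ZVar n)
  end.
(* Decides equalities that hold in every abelian group. *)
Ltac zmod :=
  lazymatch goal with
  | |- @eq ?V ?a ?b =>
      let l0 := zmod_atoms a (@nil V) in
      let l := zmod_atoms b l0 in
      let a' := zmod_reify a l in
      let b' := zmod_reify b l in
      exact (@zeval_eq _ l a' b' (erefl true))
  end.

Local Notation "a *:r x" := ((a%:C)%C *: x) (at level 40).

Section RealComplex.
Context {R : realType}.
Implicit Types a b : R.

Lemma realcD a b : (a + b)%:C%C = a%:C%C + b%:C%C.
Proof. exact: rmorphD. Qed.

Lemma realcN a : (- a)%:C%C = - a%:C%C.
Proof. exact: rmorphN. Qed.

Lemma realcM a b : (a * b)%:C%C = a%:C%C * b%:C%C.
Proof. exact: rmorphM. Qed.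

Lemma normcR a : `|a%:C%C| = (`|a|)%:C%C.
Proof. by rewrite normc_def/= expr0n/= addr0 sqrtr_sqr. Qed.

End RealComplex.

Section RealNorm.
Context {R : realType} {X : normedModType R[i]}.
Implicit Types (a b : R) (x y z : X).

Lemma normE x : `|x| = (rnorm x)%:C%C.
Proof. by rewrite /rnorm RRe_real// ger0_real. Qed.

Lemma rnorm_ge0 x : 0 <= rnorm x.
Proof. by rewrite -ler0c -normE. Qed.

Lemma ler_rnormD x y : rnorm (x + y) <= rnorm x + rnorm y.
Proof. by rewrite -lecR realcD -!normE ler_normD. Qed.

Lemma rnorm0 : rnorm (0 : X) = 0.
Proof. by rewrite /rnorm normr0. Qed.

Lemma rnormN x : rnorm (- x) = rnorm x.
Proof. by rewrite /rnorm normrN. Qed.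

Lemma rnormC x y : rnorm (x - y) = rnorm (y - x).
Proof. by rewrite -rnormN opprB. Qed.

Lemma rnorm_eq0 x : rnorm x = 0 -> x = 0.
Proof. by move=> h; apply/eqP; rewrite -normr_eq0 normE h. Qed.

Lemma rnormZ a x : rnorm (a *:r x) = `|a| * rnorm x.
Proof. by rewrite {1}/rnorm normrZ normcR (normE x) -realcM. Qed.

Lemma ler_rnormB x y : rnorm (x - y) <= rnorm x + rnorm y.
Proof. by rewrite -(rnormN y) ler_rnormD. Qed.

Lemma ler_rdistD z x y : rnorm (x - y) <= rnorm (x - z) + rnorm (z - y).
Proof. by have := ler_rnormD (x - z) (z - y); rewrite subrKA. Qed.

Lemma lerB_rnorm x y : rnorm x - rnorm y <= rnorm (x - y).
Proof. by rewrite lerBlDr -{1}(subrK y x) ler_rnormD. Qed.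

Lemma rscalerDl a b x : (a + b) *:r x = a *:r x + b *:r x.
Proof. by rewrite realcD scalerDl. Qed.

Lemma rscalerBl a b x : (a - b) *:r x = a *:r x - b *:r x.
Proof. by rewrite realcD realcN scalerBl. Qed.

Lemma rscalerA a b x : a *:r (b *:r x) = (a * b) *:r x.
Proof. by rewrite scalerA realcM. Qed.

Lemma rscale1r x : 1 *:r x = x.
Proof. by rewrite scale1r. Qed.

Lemma rscale0r x : 0 *:r x = 0.
Proof. by rewrite scale0r. Qed.

Lemma rscaleNr a x : (- a) *:r x = - (a *:r x).
Proof. by rewrite realcN scaleNr. Qed.

Lemma rscaler_half x : 2^-1 *:r x + 2^-1 *:r x = x.
Proof. by rewrite -rscalerDl (_ : 2^-1 + 2^-1 = 1 :> R) ?rscale1r//; lra. Qed.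

Lemma rcvgP {T : Type} (F : set_system T) {FF : Filter F} (f : T -> X) l :
  f @ F --> l <-> forall e : R, 0 < e -> \forall t \near F, rnorm (f t - l) <= e.
Proof.
split.
- move=> /cvgrPdist_le h e e0.
  have := h e%:C%C; rewrite ltcR => /(_ e0).
  by apply: filterS => t; rewrite normE lecR rnormC.
- move=> h; apply/cvgrPdist_le => e e0.
  (* A positive element of [R[i]] is real, so complex radii are real radii. *)
  have eE : e = (complex.Re e)%:C%C by rewrite RRe_real// gtr0_real.
  rewrite eE; apply: filterS (h (complex.Re e) _); last by rewrite -ltcR -eE.
  by move=> t; rewrite normE lecR rnormC.
Qed.

Definition tends (u : nat -> X) l :=
  forall e : R, 0 < e -> \forall n \near \oo, rnorm (u n - l) <= e.

Lemma tends_unique (u : nat -> X) k l : tends u k -> tends u l -> k = l.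
Proof. by move=> /rcvgP h1 /rcvgP h2; exact: (cvg_unique _ h1 h2). Qed.

End RealNorm.

Section Completeness.
Context {R : realType} {X : completeNormedModType R[i]}.

Lemma rcauchy_cvg (u : nat -> X) :
  (forall e : R, 0 < e -> exists N : nat, forall m n : nat, (N <= m)%N -> (m <= n)%N ->
     rnorm (u n - u m) <= e) ->
  exists l, tends u l.
Proof.
move=> h; suff : cvgn u by move=> /rcvgP cu; exists (limn u).
apply/cauchy_cvgP/cauchy_exP => e e0.
have eE : e = (complex.Re e)%:C%C by rewrite RRe_real// gtr0_real.
have re0 : 0 < complex.Re e by rewrite -ltcR -eE.
have [N hN] := h (complex.Re e / 2) (divr_gt0 re0 (ltr0Sn _ _)).
exists (u N); exists N => // n /= Nn.
rewrite -ball_normE /ball_/= normE eE ltcR rnormC.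
apply: le_lt_trans (hN N n (leqnn _) Nn) _.
by rewrite ltr_pdivrMr// ltr_pMr// ltr1n.
Qed.

End Completeness.

(** * Interval induction and a mean value inequality *)

Section IntervalInduction.
Context {R : realType}.

(** Cousin's lemma. The supremum c of the points reached from a is itself reached, by the local
    hypothesis at c on an interval ending beyond c; unless c = b, this same interval leads past
    c. *)
Lemma cousin (P : R -> R -> Prop) (a b : R) : a <= b ->
  (forall p q r, a <= p -> p <= q -> q <= r -> r <= b -> P p q -> P q r -> P p r) ->
  (forall t, a <= t -> t <= b -> exists2 d : R, 0 < d &
     forall p q, a <= p -> p <= t -> t <= q -> q <= b -> t - d < p -> q < t + d -> P p q) ->
  P a b.
Proof.
move=> ab trans loc.
pose S := [set c | [/\ a <= c, c <= b & P a c]].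
have Sa : S a.
  split => //; have [d d0] := loc a (lexx _) ab; apply => //.
    by rewrite ltrBlDr ltrDl.
  by rewrite ltrDl.
have Sub : has_ubound S by exists b => c [].
have Ssup : has_sup S by split => //; exists a.
pose c := sup S.
have ac : a <= c by apply: ub_le_sup.
have cb : c <= b by apply: ge_sup; [exists a|move=> ? []].
have [d d0 hd] := loc c ac cb.
have [p [ap pb Pp] cdp] := sup_adherent d0 Ssup.
have pc : p <= c by apply: ub_le_sup.
pose q := Num.min (c + d / 2) b.
have cq : c <= q by rewrite le_min cb andbT lerDl divr_ge0// ltW.
have qb : q <= b by rewrite ge_min lexx orbT.
have qd : q < c + d.
  apply: le_lt_trans (_ : c + d / 2 < _); first by rewrite ge_min lexx.
  by rewrite ltrD2l ltr_pdivrMr// ltr_pMr// ltr1n.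
have Paq : P a q.
  apply: (trans a p q) => //; first exact: le_trans cq.
  exact: hd.
have qc : q <= c by apply: ub_le_sup => //; split => //; exact: le_trans cq.
suff -> : b = q by [].
apply/eqP; rewrite eq_le qb andbT leNgt; apply/negP => qb'.
move: qc; rewrite leNgt => /negP; apply; rewrite /q lt_min.
by rewrite ltrDl divr_gt0//=; apply: le_lt_trans cq _.
Qed.

(** The local bound holds on both sides of t, so splitting at t covers every small interval around
    t, and [cousin] patches these intervals. *)
Lemma mean_value_ineq {X : normedModType R[i]} (f : R -> X) (a b M : R) : a <= b ->
  (forall t, a <= t -> t <= b -> forall e : R, 0 < e -> exists2 d : R, 0 < d &
    forall s, a <= s -> s <= b -> `|s - t| < d ->
      rnorm (f s - f t) <= (M + e) * `|s - t|) ->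
  rnorm (f b - f a) <= M * (b - a).
Proof.
move=> ab h; apply/ler_addgt0Pr => e e0.
(* The added 1 keeps the denominator positive when a = b. *)
pose e' := e / (b - a + 1).
have ba1 : 0 < b - a + 1 by rewrite ltr_wpDl// subr_ge0.
have e'0 : 0 < e' by rewrite divr_gt0.
suff H : rnorm (f b - f a) <= (M + e') * (b - a).
  apply: le_trans H _; rewrite mulrDl lerD2l /e' mulrAC ler_pdivrMr//.
  by rewrite ler_pM2l// lerDl.
apply: (@cousin (fun p q => rnorm (f q - f p) <= (M + e') * (q - p))) => //.
- move=> p q r _ _ _ _ h1 h2.
  apply: le_trans (ler_rdistD (f q) _ _) _.
  by apply: le_trans (lerD h2 h1) _; rewrite -mulrDr addrA subrK.
- move=> t at_ tb; have [d d0 hd] := h t at_ tb e' e'0.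
  exists d => // p q ap pt tq qb dp dq.
  apply: le_trans (ler_rdistD (f t) _ _) _.
  have hq := hd q (le_trans at_ tq) qb.
  have hp := hd p ap (le_trans pt tb).
  rewrite ger0_norm ?subr_ge0// in hq; rewrite ler0_norm ?subr_le0// opprB in hp.
  rewrite (rnormC (f t)).
  have -> : q - p = (q - t) + (t - p) by ring.
  rewrite mulrDr lerD//; first by apply: hq; rewrite ltrBlDl.
  by apply: hp; rewrite ltrBlDr -ltrBlDl.
Qed.

End IntervalInduction.

(** * Uniform convexity for vectors of nearly equal norm *)

Section UniformConvexity.
Context {R : realType} {X : normedModType R[i]}.

Lemma realc_half : (2^-1 : R)%:C%C = 2^-1.
Proof. by rewrite (_ : 2^-1%:C%C = real_complex R 2^-1)// fmorphV rmorph_nat. Qed.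

(** A long midpoint forces both vectors to be long, of norm at least L(1 - 3d), so replacing them by
    L times unit vectors moves each by at most 3dL. *)
Lemma uniformly_convex_scaled (L eps : R) :
  uniformly_convex X -> 0 < L -> 0 < eps ->
  exists2 d : R, 0 < d & forall x y : X,
    rnorm x <= L * (1 + d) -> rnorm y <= L * (1 + d) ->
    L * (1 - d) <= rnorm (2^-1 *:r (x + y)) -> rnorm (x - y) <= eps.
Proof.
move=> uc L0 e0.
have [d0 d00 hd0] := uc (eps / (2 * L)) (divr_gt0 e0 (mulr_gt0 (ltr0Sn _ _) L0)).
(* The bound 1/8 keeps 1 - 3d positive; d0/8 leaves the normalized midpoint longer than 1 - d0, as
   it loses at most 4d; eps/(12L) makes the two errors 3dL add up to at most eps/2. *)
pose d := Num.min (8^-1) (Num.min (d0 / 8) (eps / (12 * L))).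
have dpos : 0 < d by rewrite !lt_min invr_gt0 ltr0Sn !divr_gt0 ?mulr_gt0.
have d8 : d <= 8^-1 by rewrite ge_min lexx.
have dd0 : d <= d0 / 8 by rewrite !ge_min lexx !orbT.
have de : d * (12 * L) <= eps.
  by rewrite -ler_pdivlMr ?mulr_gt0// !ge_min lexx !orbT.
exists d => // x y hx hy hxy.
have mid : rnorm (2^-1 *:r (x + y)) <= 2^-1 * (rnorm x + rnorm y).
  by rewrite rnormZ ger0_norm ?invr_ge0// ler_wpM2l ?invr_ge0// ler_rnormD.
have Ld : 0 <= L * (8^-1 - d) by rewrite mulr_ge0 ?subr_ge0// ltW.
have Ld0 : 0 < L * d by rewrite mulr_gt0.
have lx : L * (1 - 3 * d) <= rnorm x by nra.
have ly : L * (1 - 3 * d) <= rnorm y by nra.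
have unit z : L * (1 - 3 * d) <= rnorm z -> rnorm z <= L * (1 + d) ->
    exists u : X, rnorm u = 1 /\ rnorm (z - L *:r u) <= 3 * d * L.
  move=> lz uz; have z0 : 0 < rnorm z by nra.
  exists ((rnorm z)^-1 *:r z); split.
    by rewrite rnormZ ger0_norm ?invr_ge0 ?mulVf ?gt_eqF// ltW.
  rewrite -{1}(rscale1r z) rscalerA -rscalerBl rnormZ -[X in _ * X <= _]gtr0_norm//.
  rewrite -normrM mulrBl mul1r divfK ?gt_eqF// ler_norml; nra.
have [u [u1 hu]] := unit x lx hx.
have [v [v1 hv]] := unit y ly hy.
have uv : 1 - d0 < rnorm (2^-1 *:r (u + v)).
  have : rnorm (2^-1 *:r (x + y)) <= L * rnorm (2^-1 *:r (u + v)) + 3 * d * L.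
    have -> : 2^-1 *:r (x + y) = L *:r (2^-1 *:r (u + v)) +
        (2^-1 *:r (x - L *:r u) + 2^-1 *:r (y - L *:r v)).
      rewrite -scalerDr addrACA -opprD -scalerDr scalerBr !rscalerA.
      by rewrite (mulrC L) addrCA subrr addr0.
    apply: le_trans (ler_rnormD _ _) _.
    rewrite rnormZ gtr0_norm// lerD2l; apply: le_trans (ler_rnormD _ _) _.
    rewrite !rnormZ ger0_norm ?invr_ge0//; lra.
  nra.
have := hd0 u v u1 v1; rewrite -realc_half => /(_ uv)/ltW huv.
have -> : x - y = L *:r (u - v) + ((x - L *:r u) - (y - L *:r v)).
  by rewrite scalerBr opprB addrACA (addrC x (- (L *:r u))) addNKr addKr.
apply: le_trans (ler_rnormD _ _) _.
have := ler_rnormB (x - L *:r u) (y - L *:r v).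
rewrite rnormZ gtr0_norm//.
have : L * rnorm (u - v) <= eps / 2.
  apply: le_trans (_ : L * (eps / (2 * L)) <= _); first by rewrite ler_pM2l.
  by rewrite le_eqVlt; apply/orP; left; apply/eqP; field; rewrite gt_eqF.
lra.
Unshelve. all: by [].
Qed.

End UniformConvexity.

(** * Quasi-contractive groups *)

Section Linear.
Context {R : realType} {X : normedModType R[i]}.

Definition lin (B : X -> X) :=
  forall (a : R[i]) (x y : X), B (a *: x + y) = a *: B x + B y.

Variable B : X -> X.
Hypothesis linB : lin B.

Lemma linD x y : B (x + y) = B x + B y.
Proof. by rewrite -[x]scale1r linB !scale1r. Qed.

Lemma lin0 : B 0 = 0.
Proof. by apply: (addrI (B 0)); rewrite -linD !addr0. Qed.

Lemma linZ a x : B (a *: x) = a *: B x.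
Proof. by rewrite -[a *: x]addr0 linB lin0 addr0. Qed.

Lemma linN x : B (- x) = - B x.
Proof. by rewrite -scaleN1r linZ scaleN1r. Qed.

Lemma linsub x y : B (x - y) = B x - B y.
Proof. by rewrite linD linN. Qed.

End Linear.

Section Quasicontractive.
Context {R : realType} {X : normedModType R[i]}.
Implicit Types (G : R -> X -> X) (D : set X) (A : X -> X).

Definition rderiv G (y v : X) := forall e : R, 0 < e -> exists2 d : R, 0 < d &
  forall h, `|h| < d -> rnorm (G h y - y - h *:r v) <= e * `|h|.

(** [qg_dom] and [qg_gen] together say that D is exactly the domain of the generator. The rate is
    taken nonnegative so that the exponential bounds increase with |s|. *)
Record qgroup (w : R) D A G : Prop := QGroup {
  qg_ge0 : 0 <= w;
  qg_lin : forall s, lin (G s);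
  qg_0 : forall x, G 0 x = x;
  qg_D : forall s t x, G (s + t) x = G s (G t x);
  qg_bound : forall s x, rnorm (G s x) <= expR (w * `|s|) * rnorm x;
  qg_cont : forall x (e : R), 0 < e -> exists2 d : R, 0 < d &
    forall s, `|s| < d -> rnorm (G s x - x) <= e;
  qg_dom : forall y v, rderiv G y v -> D y;
  qg_gen : forall y, D y -> rderiv G y (A y) }.

End Quasicontractive.

Section OneGroup.
Context {R : realType} {X : normedModType R[i]}.
Variables (w : R) (D : set X) (A : X -> X) (G : R -> X -> X).
Hypothesis HG : qgroup w D A G.
Let w0 := qg_ge0 HG.
Let Glin := qg_lin HG.
Let G0 := qg_0 HG.
Let GD := qg_D HG.
Let Gbd := qg_bound HG.

Lemma qg_bound_le c s x : `|s| <= c -> rnorm (G s x) <= expR (w * c) * rnorm x.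
Proof.
move=> sc; apply: le_trans (Gbd _ _) _.
by rewrite ler_wpM2r ?rnorm_ge0// ler_expR ler_wpM2l.
Qed.

Lemma qg_NK s x : G (- s) (G s x) = x.
Proof. by rewrite -GD addNr G0. Qed.

Lemma qg_KN s x : G s (G (- s) x) = x.
Proof. by rewrite -GD subrr G0. Qed.

Lemma rderiv_unique y v v' : rderiv G y v -> rderiv G y v' -> v = v'.
Proof.
move=> h1 h2; apply/eqP; rewrite -subr_eq0; apply/eqP/rnorm_eq0/eqP.
rewrite eq_le rnorm_ge0 andbT; apply/ler_addgt0Pr => e e0; rewrite add0r.
have e20 : 0 < e / 2 by rewrite divr_gt0.
have [d1 d10 H1] := h1 _ e20; have [d2 d20 H2] := h2 _ e20.
pose h := Num.min d1 d2 / 2.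
have m0 : 0 < Num.min d1 d2 by rewrite lt_min d10.
have h0 : 0 < h by rewrite divr_gt0.
have hm : h < Num.min d1 d2 by rewrite ltr_pdivrMr// ltr_pMr// ltr1n.
move: (hm); rewrite lt_min => /andP[hd1 hd2].
have := H1 h; have := H2 h; rewrite gtr0_norm// => /(_ hd2) k2 /(_ hd1) k1.
have : rnorm (h *:r (v - v')) <= e * h.
  have -> : h *:r (v - v') = (G h y - y - h *:r v') - (G h y - y - h *:r v).
    by rewrite scalerBr; zmod.
  by apply: le_trans (ler_rnormB _ _) _; lra.
by rewrite rnormZ gtr0_norm// mulrC ler_pM2r.
Qed.

Lemma rderiv_gen y v : rderiv G y v -> A y = v.
Proof. by move=> h; exact (rderiv_unique (qg_gen HG (qg_dom HG h)) h). Qed.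

Lemma rderiv_comb a x y v v' : rderiv G x v -> rderiv G y v' ->
  rderiv G (a *:r x + y) (a *:r v + v').
Proof.
move=> h1 h2 e e0.
have a1 : 0 < 1 + `|a| by rewrite ltr_pwDl.
have e'0 : 0 < e / (1 + `|a|) by rewrite divr_gt0.
have [d1 d10 H1] := h1 _ e'0; have [d2 d20 H2] := h2 _ e'0.
exists (Num.min d1 d2); first by rewrite lt_min d10.
move=> h; rewrite lt_min => /andP[/H1 k1 /H2 k2].
have -> : G h (a *:r x + y) - (a *:r x + y) - h *:r (a *:r v + v') =
    a *:r (G h x - x - h *:r v) + (G h y - y - h *:r v').
  by rewrite Glin !scalerBr scalerDr !rscalerA (mulrC h); zmod.
apply: le_trans (ler_rnormD _ _) _; rewrite rnormZ.
have : `|a| * rnorm (G h x - x - h *:r v) <= `|a| * (e / (1 + `|a|) * `|h|).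
  by rewrite ler_wpM2l.
have : e = e / (1 + `|a|) * (1 + `|a|) by rewrite divfK ?gt_eqF.
move: k2; set q := e / _ => k2 -> k3; lra.
Qed.

Lemma dom_comb a x y : D x -> D y -> D (a *:r x + y).
Proof.
by move=> /(qg_gen HG) hx /(qg_gen HG) hy; exact (qg_dom HG (rderiv_comb a hx hy)).
Qed.

Lemma gen_comb a x y : D x -> D y -> A (a *:r x + y) = a *:r A x + A y.
Proof.
by move=> /(qg_gen HG) hx /(qg_gen HG) hy; exact (rderiv_gen (rderiv_comb a hx hy)).
Qed.

Lemma rderiv_0 : rderiv G 0 0.
Proof.
move=> e e0; exists 1 => // h _.
by rewrite (lin0 (Glin h)) subrr scaler0 subrr rnorm0 mulr_ge0// ltW.
Qed.

Lemma dom0 : D 0.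
Proof. exact (qg_dom HG rderiv_0). Qed.

Lemma gen0 : A 0 = 0.
Proof. exact (rderiv_gen rderiv_0). Qed.

Lemma domZ a x : D x -> D (a *:r x).
Proof. by move=> Dx; rewrite -[_ *:r _]addr0; apply: dom_comb => //; exact: dom0. Qed.

Lemma genZ a x : D x -> A (a *:r x) = a *:r A x.
Proof.
by move=> Dx; rewrite -[a *:r x]addr0 gen_comb ?gen0 ?addr0//; exact: dom0.
Qed.

Lemma domD x y : D x -> D y -> D (x + y).
Proof. by move=> Dx Dy; rewrite -[x]rscale1r; exact: dom_comb. Qed.

Lemma genD x y : D x -> D y -> A (x + y) = A x + A y.
Proof. by move=> Dx Dy; rewrite -[x]rscale1r gen_comb// !rscale1r. Qed.

Lemma domB x y : D x -> D y -> D (x - y).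
Proof. by move=> Dx Dy; rewrite addrC -(rscale1r y) -rscaleNr; exact: dom_comb. Qed.

Lemma genB x y : D x -> D y -> A (x - y) = A x - A y.
Proof.
move=> Dx Dy; rewrite addrC -{1}(rscale1r y) -rscaleNr gen_comb//.
by rewrite rscaleNr rscale1r addrC.
Qed.

Lemma rderiv_group s y v : rderiv G y v -> rderiv G (G s y) (G s v).
Proof.
move=> h e e0; have [d d0 H] := h (e / expR (w * `|s|)) (divr_gt0 e0 (expR_gt0 _)).
exists d => // k /H hk.
have -> : G k (G s y) - G s y - k *:r G s v = G s (G k y - y - k *:r v).
  by rewrite !(linsub (Glin s)) (linZ (Glin s)) -!GD (addrC k).
apply: le_trans (Gbd _ _) _; rewrite mulrC -ler_pdivlMr ?expR_gt0//.
by apply: le_trans hk _; rewrite mulrAC.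
Qed.

Lemma group_dom s y : D y -> D (G s y).
Proof. by move=> /(qg_gen HG)/(rderiv_group s)/(qg_dom HG). Qed.

Lemma gen_group s y : D y -> A (G s y) = G s (A y).
Proof. by move=> /(qg_gen HG)/(rderiv_group s)/rderiv_gen. Qed.

Lemma group_lipschitz h y : D y ->
  rnorm (G h y - y) <= `|h| * expR (w * `|h|) * rnorm (A y).
Proof.
(* Rescaling the orbit to [0, 1] treats both signs of h at once. *)
move=> Dy; pose f r := G (r * h) y.
have : rnorm (f 1 - f 0) <= `|h| * expR (w * `|h|) * rnorm (A y) * (1 - 0).
  apply: mean_value_ineq => // t t0 t1 e e0.
  have [h0|hn0] := eqVneq h 0.
    exists 1 => // s _ _ _; rewrite /f h0 !mulr0 subrr rnorm0 mulr_ge0//.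
    by rewrite normr0 !mul0r add0r ltW.
  have p0 : 0 < `|h| * expR (w * `|h|) by rewrite mulr_gt0 ?normr_gt0 ?expR_gt0.
  have [d d0 H] := qg_gen HG Dy (divr_gt0 e0 p0).
  exists (d / `|h|); first by rewrite divr_gt0 ?normr_gt0.
  move=> s s0 s1; rewrite ltr_pdivlMr ?normr_gt0// -normrM => /H.
  set k := (s - t) * h => hk.
  have -> : f s - f t = G (t * h) (G k y - y).
    by rewrite (linsub (Glin _)) -GD /f /k; do 3 f_equal; ring.
  have th : `|t * h| <= `|h| by rewrite normrM ger0_norm// ler_piMl.
  apply: le_trans (qg_bound_le _ th) _.
  have : rnorm (G k y - y) <= `|k| * (rnorm (A y) + e / (`|h| * expR (w * `|h|))).
    rewrite -(subrK (k *:r A y) (G k y - y)); apply: le_trans (ler_rnormD _ _) _.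
    by rewrite rnormZ mulrDr addrC lerD2l mulrC.
  rewrite -(ler_pM2l (expR_gt0 (w * `|h|))) => /le_trans; apply.
  rewrite /k normrM le_eqVlt; apply/orP; left; apply/eqP; field.
  by rewrite normr_eq0 hn0 gt_eqF ?expR_gt0.
by rewrite /f mul1r mul0r G0 subr0 mulr1.
Qed.

(** Converse of [group_lipschitz]. Together they describe |A y| as the least M with |G h y - y| <=
    |h| exp(w|h|) M for all h. For fixed h this condition is continuous in y and does not mention A,
    hence the semicontinuity in [gen_lsc_near]. *)
Lemma rderiv_bound y v M : 0 <= M ->
  (forall h, rnorm (G h y - y) <= `|h| * expR (w * `|h|) * M) ->
  rderiv G y v -> rnorm v <= M.
Proof.
move=> M0 hM hv; apply/ler_addgt0Pr => e e0.
have e20 : 0 < e / 2 by rewrite divr_gt0.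
have [d d0 H] := hv _ e20.
have : \forall h \near (0 : R), expR (w * h) * M < M + e / 2.
  have : expR (w * h) * M @[h --> (0:R)] --> expR (w * 0) * M.
    apply: cvgMl; apply: continuous_cvg; first exact: continuous_expR.
    by apply: cvgMr; exact: cvg_id.
  by move/cvgr_lt; apply; rewrite mulr0 expR0 mul1r ltrDl.
move=> /nbhs_ballP[r r0 hr].
pose m := Num.min d r; have m0 : 0 < m by rewrite lt_min d0.
pose h := m / 2; have h0 : 0 < h by rewrite divr_gt0.
have : h < m by rewrite ltr_pdivrMr// ltr_pMr// ltr1n.
rewrite lt_min => /andP[hd h_r].
have /hr/= k1 : ball 0 r h by rewrite /ball/= sub0r normrN gtr0_norm.
have := H h; rewrite gtr0_norm// => /(_ hd) k2.
have := hM h; rewrite gtr0_norm// -mulrA => k3.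
have : rnorm (h *:r v) <= h * (M + e).
  have -> : h *:r v = (G h y - y) - (G h y - y - h *:r v) by zmod.
  apply: le_trans (ler_rnormB _ _) _; nra.
by rewrite rnormZ gtr0_norm// ler_pM2l.
Qed.

End OneGroup.

(** * Dyadic averages over orbits *)

Section DyadicAverages.
Context {R : realType} {X : normedModType R[i]}.
Variables (w : R) (D : set X) (A : X -> X) (G : R -> X -> X).
Hypothesis HG : qgroup w D A G.
Let w0 := qg_ge0 HG.
Let Glin := qg_lin HG.
Let G0 := qg_0 HG.
Let GD := qg_D HG.
Let Gbd := qg_bound HG.

Definition dy (n : nat) : R := 2^-1 ^+ n.

Lemma dy_gt0 n : 0 < dy n.
Proof. by rewrite exprn_gt0. Qed.

Lemma dyS n : dy n = dy n.+1 + dy n.+1.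
Proof. by rewrite /dy exprS; lra. Qed.

Lemma dy_le m n : (m <= n)%N -> dy n <= dy m.
Proof. by move=> mn; rewrite ler_wiXn2l ?invf_le1 ?ler1n. Qed.

Lemma dy_le1 n : dy n <= 1.
Proof. exact: (dy_le (leq0n n)). Qed.

Lemma near_dy (e : R) : 0 < e -> \forall n \near \oo, dy n <= e.
Proof.
move=> e0.
have : dy @ \oo --> (0 : R) by apply: cvg_expr; rewrite ger0_norm ?invf_lt1// ltr1n.
by move/cvgr_le; apply.
Qed.

Lemma dy_small (e : R) : 0 < e -> exists n, dy n <= e.
Proof. by move=> /near_dy[n _ hn]; exists n; apply: hn => /=. Qed.

Lemma group_small x (e : R) : 0 < e ->
  exists n, forall s, 0 <= s -> s <= dy n -> rnorm (G s x - x) <= e.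
Proof.
move=> e0; have [d d0 hd] := qg_cont HG x e0.
have [n hn] := dy_small (divr_gt0 d0 (ltr0Sn R 1)).
exists n => s s0 sn; apply: hd; rewrite ger0_norm//.
by apply: le_lt_trans (le_trans sn hn) _; rewrite ltr_pdivrMr// ltr_pMr// ltr1n.
Qed.

(** Unrolled, this is the mean of G(j 2^-(n+k)) x over 0 <= j < 2^k, a Riemann sum for the mean of
    the orbit over [0, 2^-n]. *)
Fixpoint avg (k n : nat) (x : X) : X :=
  if k is k'.+1 then 2^-1 *:r (avg k' n.+1 x + avg k' n.+1 (G (dy n.+1) x)) else x.

(** The average is a convex combination of points of the orbit over [0, 2^-n], and balls are
    convex. *)
Lemma avg_hull k n x c (e : R) :
  (forall s, 0 <= s -> s <= dy n -> rnorm (G s x - c) <= e) ->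
  rnorm (avg k n x - c) <= e.
Proof.
elim: k n x => [|k IH] n x h /=.
  by rewrite -[x in x - c]G0; apply: h => //; rewrite ltW ?dy_gt0.
have d1 := dy_gt0 n.+1; have dd := dyS n.
have h1 : rnorm (avg k n.+1 x - c) <= e.
  by apply: IH => s s0 sn; apply: h => //; lra.
have h2 : rnorm (avg k n.+1 (G (dy n.+1) x) - c) <= e.
  by apply: IH => s s0 sn; rewrite -GD; apply: h; lra.
rewrite -(rscaler_half c) -scalerDr -scalerBr rnormZ ger0_norm ?invr_ge0//.
have -> : avg k n.+1 x + avg k n.+1 (G (dy n.+1) x) - (c + c) =
  (avg k n.+1 x - c) + (avg k n.+1 (G (dy n.+1) x) - c) by zmod.
have := ler_rnormD (avg k n.+1 x - c) (avg k n.+1 (G (dy n.+1) x) - c); lra.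
Qed.

Lemma avg_bound k n x : rnorm (avg k n x) <= expR (w * dy n) * rnorm x.
Proof.
rewrite -[avg k n x]subr0; apply: avg_hull => s s0 sn; rewrite subr0.
by apply: (qg_bound_le HG); rewrite ger0_norm.
Qed.

Lemma avg_lin k n : lin (avg k n).
Proof.
elim: k n => [|k IH] n a x y //=.
by rewrite Glin !IH addrACA !scalerDr !scalerA (mulrC a).
Qed.

Lemma avg_group k n s x : avg k n (G s x) = G s (avg k n x).
Proof.
elim: k n x => [|k IH] n x //=.
by rewrite (linZ (Glin s)) (linD (Glin s)) -!IH -!GD (addrC s).
Qed.

Lemma avg_comp k j n x : avg (k + j) n x = avg k n (avg j (n + k) x).
Proof.
elim: k n x => [|k IH] n x /=; first by rewrite addn0.
by rewrite !IH addSnnS (avg_group j).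
Qed.

Lemma avg_comm k n j m x : avg k n (avg j m x) = avg j m (avg k n x).
Proof.
elim: k n x => [|k IH] n x //=.
by rewrite -avg_group !IH (linZ (avg_lin _ _)) (linD (avg_lin _ _)).
Qed.

Definition dyq (n : nat) (x : X) : X := (2 ^+ n) *:r (G (dy n) x - x).

Lemma dyqK n x : dy n *:r dyq n x = G (dy n) x - x.
Proof. by rewrite rscalerA /dy -exprMn mulVf// expr1n rscale1r. Qed.

(** The increment over [0, 2^-n] telescopes into the increments over its 2^k dyadic cells, so a
    coarse quotient is the average of a fine one. *)
Lemma dyq_avg k n x : dyq n x = avg k n (dyq (n + k) x).
Proof.
elim: k n => [|k IH] n /=; first by rewrite addn0.
rewrite avg_group -addSnnS -IH /dyq exprSr.
rewrite (linZ (Glin _)) (linsub (Glin _)) -!GD -dyS -scalerDr rscalerA mulrC mulfK//.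
by congr (_ *:r _); zmod.
Qed.

Lemma avg_dyq k n m x : avg k n (dyq m x) = dyq m (avg k n x).
Proof. by rewrite /dyq (linZ (@avg_lin k n)) (linsub (@avg_lin k n)) avg_group. Qed.

(** Each of the k steps contributes its local error, transported by the group ([c1]), and the
    oscillation of the orbit of z ([c2]). *)
Lemma group_telescope (z y : X) (d c1 c2 h : R) (k : nat) :
  0 <= d -> k%:R * d <= h ->
  rnorm (G d y - y - d *:r z) <= d * c1 ->
  (forall s, 0 <= s -> s <= h -> rnorm (G s z - z) <= c2) ->
  rnorm (G (k%:R * d) y - y - (k%:R * d) *:r z) <=
    k%:R * d * (expR (w * h) * c1 + c2).
Proof.
move=> d0 + h1 h2; elim: k => [_|k IH kh].
  by rewrite !mul0r G0 subrr rscale0r subrr rnorm0.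
have kd : 0 <= k%:R * d by rewrite mulr_ge0.
have kS : k.+1%:R * d = k%:R * d + d by rewrite -addn1 natrD mulrDl mul1r.
have kh' : k%:R * d <= h by lra.
have -> : G (k.+1%:R * d) y - y - (k.+1%:R * d) *:r z =
  (G (k%:R * d) y - y - (k%:R * d) *:r z) +
  (G (k%:R * d) (G d y - y - d *:r z) + d *:r (G (k%:R * d) z - z)).
  by rewrite kS GD rscalerDl !(linsub (Glin _)) (linZ (Glin _)) scalerBr; zmod.
apply: le_trans (ler_rnormD _ _) _; rewrite kS [in leRHS]mulrDl.
apply: lerD; first exact: IH.
apply: le_trans (ler_rnormD _ _) _; rewrite mulrDr; apply: lerD.
  apply: le_trans (qg_bound_le HG (c := h) _ _) _; first by rewrite ger0_norm.
  by rewrite mulrCA ler_wpM2l ?expR_ge0.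
by rewrite rnormZ ger0_norm// ler_wpM2l// h2.
Qed.

(* Convergence of the difference quotients along h = 2^-n implies convergence
   along all h, because G(h)y - y is a limit of Riemann sums of the orbit of z. *)
Lemma rderiv_dyadic y z : tends (dyq^~ y) z -> rderiv G y z.
Proof.
move=> hz e e0.
have E0 := expR_gt0 w.
have q0 : 0 < expR w + 1 by rewrite addr_gt0.
(* Positive h needs only [e1]; the factor [expR w] pays for the transport to negative h at the
   end. *)
pose e1 := e / (2 * (expR w + 1)); have e10 : 0 < e1 by rewrite divr_gt0 ?mulr_gt0.
have eE : e = e1 * (2 * (expR w + 1)) by rewrite divfK// mulf_neq0// gt_eqF.
have [n hn] := group_small z (divr_gt0 e10 (ltr0Sn R 1)).
have pos h : 0 < h -> h < dy n -> rnorm (G h y - y - h *:r z) <= e1 * h.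
  move=> h0 hd; apply/ler_addgt0Pr => eta eta0.
  have h1 : h <= 1 by apply: le_trans (ltW hd) (dy_le1 n).
  have eta4 : 0 < eta / 2 by rewrite divr_gt0.
  pose c1 := e1 / 2 / expR w; have c10 : 0 < c1 by rewrite !divr_gt0.
  have [d d0 Hd] := qg_cont HG y (divr_gt0 eta4 E0).
  have nz0 : 0 < rnorm z + 1 by rewrite ltr_wpDl ?rnorm_ge0.
  near \oo => m.
  have m1 : rnorm (dyq m y - z) <= c1 by near: m; exact: hz.
  have m2 : dy m <= d / 2 by near: m; apply: near_dy; rewrite divr_gt0.
  have m3 : dy m <= eta / 2 / (rnorm z + 1) by near: m; apply: near_dy; rewrite divr_gt0.
  have dm0 := dy_gt0 m.
  (* h is replaced by the largest multiple of 2^-m below it; the remainder is shorter than one cell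
     and negligible for large m. *)
  pose k := Num.truncn (h / dy m).
  have /andP[k1 k2] : k%:R <= h / dy m < k.+1%:R by apply: truncn_itv; rewrite divr_ge0// ltW.
  pose s := k%:R * dy m.
  have sh : s <= h by rewrite -ler_pdivlMr.
  have hs : h - s <= dy m.
    by move: k2; rewrite ltr_pdivrMr// -addn1 natrD mulrDl mul1r -/s; lra.
  have s0 : 0 <= s by rewrite mulr_ge0// ltW.
  have := @group_telescope z y (dy m) c1 (e1 / 2) h k (ltW dm0) sh.
  have -> : G (dy m) y - y - dy m *:r z = dy m *:r (dyq m y - z).
    by rewrite scalerBr dyqK.
  rewrite rnormZ gtr0_norm// ler_pM2l// => /(_ m1).
  have hn' r : 0 <= r -> r <= h -> rnorm (G r z - z) <= e1 / 2.
    by move=> r0 rh; apply: hn => //; lra.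
  move=> /(_ hn'); rewrite -/s => T.
  have T2 : expR (w * h) * c1 <= e1 / 2.
    rewrite -[leRHS](divfK (lt0r_neq0 E0)) -/c1 mulrC ler_pM2l// ler_expR.
    by rewrite ler_piMr.
  have T3 : rnorm (G h y - G s y) <= eta / 2.
    have -> : G h y - G s y = G s (G (h - s) y - y) by rewrite (linsub (Glin s)) -GD (addrC s) subrK.
    apply: le_trans (qg_bound_le HG (c := 1) _ _) _; first by rewrite ger0_norm//; lra.
    by rewrite mulr1 mulrC -ler_pdivlMr//; apply: Hd; rewrite ger0_norm ?subr_ge0//; lra.
  have T4 : rnorm ((h - s) *:r z) <= eta / 2.
    rewrite rnormZ ger0_norm ?subr_ge0//.
    move: m3; rewrite ler_pdivlMr// => m3; have := rnorm_ge0 z; nra.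
  have -> : G h y - y - h *:r z =
    (G s y - y - s *:r z) + ((G h y - G s y) - (h - s) *:r z).
    by rewrite rscalerBl; zmod.
  apply: le_trans (ler_rnormD _ _) _; apply: lerD.
    apply: le_trans T _; nra.
  apply: le_trans (ler_rnormB _ _) _; lra.
exists (dy n); first exact: dy_gt0.
move=> h; have [h0|h0|->] := ltgtP h 0; last 1 first.
- by rewrite G0 subrr rscale0r subrr rnorm0 normr0 mulr0.
- rewrite ltr0_norm// => hd; pose k := - h; have k0 : 0 < k by rewrite oppr_gt0.
  (* Applying G h to the estimate at the positive time k = -h reverses the direction of time. *)
  have -> : G h y - y - h *:r z = - (G h (G k y - y - k *:r z)) + (- h) *:r (z - G h z).
    by rewrite !(linsub (Glin h)) (linZ (Glin h)) -GD /k subrr G0 scalerBr !rscaleNr; zmod.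
  apply: le_trans (ler_rnormD _ _) _; rewrite rnormN rnormZ gtr0_norm//.
  have B1 : rnorm (G h (G k y - y - k *:r z)) <= expR w * (e1 * k).
    apply: le_trans (qg_bound_le HG (c := 1) _ _) _.
      by rewrite ltr0_norm// (le_trans (ltW hd))// dy_le1.
    by rewrite mulr1 ler_pM2l// pos.
  have B2 : rnorm (z - G h z) <= expR w * (e1 / 2).
    have -> : z - G h z = G h (G k z - z) by rewrite (linsub (Glin h)) -GD subrr G0.
    apply: le_trans (qg_bound_le HG (c := 1) _ _) _.
      by rewrite ltr0_norm// (le_trans (ltW hd))// dy_le1.
    by rewrite mulr1 ler_pM2l// hn// ltW.
  have B3 : k * rnorm (z - G h z) <= k * (expR w * (e1 / 2)) by rewrite ler_pM2l.
  have e1k : 0 < e1 * k by rewrite mulr_gt0.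
  have Ee1k : 0 < expR w * (e1 * k) by rewrite mulr_gt0.
  move: B1 B3 Ee1k e1k; rewrite eE -/k; clearbody k e1; lra.
- rewrite gtr0_norm// => hd; apply: le_trans (pos h h0 hd) _.
  by rewrite ler_pM2r// eE ler_pMr//; lra.
Unshelve. all: by end_near.
Qed.

End DyadicAverages.

Section Tends.
Context {R : realType} {X : normedModType R[i]}.

Lemma tends_le (u : nat -> X) l c (M : R) :
  tends u l -> (\forall n \near \oo, rnorm (u n - c) <= M) -> rnorm (l - c) <= M.
Proof.
move=> ul uM; apply/ler_addgt0Pr => e e0; near \oo => n.
have h1 : rnorm (u n - l) <= e by near: n; exact: ul.
have h2 : rnorm (u n - c) <= M by near: n.
by have := ler_rdistD (u n) l c; rewrite (rnormC l (u n)); lra.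
Unshelve. all: by end_near.
Qed.

Lemma tends_lin (B : X -> X) (u : nat -> X) l (C : R) : lin B ->
  (forall x, rnorm (B x) <= C * rnorm x) -> tends u l -> tends (fun n => B (u n)) (B l).
Proof.
move=> linB hB ul e e0.
have C0 : 0 < `|C| + 1 by rewrite ltr_wpDl.
near=> n.
have h1 : rnorm (u n - l) <= e / (`|C| + 1) by near: n; apply: ul; rewrite divr_gt0.
rewrite -(linsub linB); apply: le_trans (hB _) _.
apply: le_trans (_ : (`|C| + 1) * rnorm (u n - l) <= _); last by rewrite mulrC -ler_pdivlMr.
by rewrite ler_wpM2r ?rnorm_ge0// (le_trans (ler_norm _))// lerDl.
Unshelve. all: by end_near.
Qed.

Lemma tendsD (u v : nat -> X) k l : tends u k -> tends v l ->
  tends (fun n => u n + v n) (k + l).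
Proof.
move=> uk vl e e0; near=> n.
have h1 : rnorm (u n - k) <= e / 2 by near: n; apply: uk; rewrite divr_gt0.
have h2 : rnorm (v n - l) <= e / 2 by near: n; apply: vl; rewrite divr_gt0.
have -> : u n + v n - (k + l) = (u n - k) + (v n - l) by zmod.
have := ler_rnormD (u n - k) (v n - l); lra.
Unshelve. all: by end_near.
Qed.

Lemma tends_cst (l : X) : tends (fun=> l) l.
Proof. by move=> e e0; near=> n; rewrite subrr rnorm0 ltW.
Unshelve. all: by end_near. Qed.

Lemma lin_scale (a : R[i]) : lin ( *:%R a : X -> X).
Proof. by move=> b x y; rewrite scalerDr !scalerA mulrC. Qed.

Lemma tendsZ a (u : nat -> X) l : tends u l -> tends (fun n => a *:r u n) (a *:r l).
Proof.
apply: (tends_lin (@lin_scale _)) => x; rewrite rnormZ; exact: lexx.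
Qed.

Lemma tendsN (u : nat -> X) l : tends u l -> tends (fun n => - u n) (- l).
Proof. by move=> ul e /ul; apply: filterS => n; rewrite -opprD rnormN. Qed.

End Tends.

(** * Semicontinuity, density and closedness of the generator *)

Section Generator.
Context {R : realType} {X : completeNormedModType R[i]}.
Variables (w : R) (D : set X) (A : X -> X) (G : R -> X -> X).
Hypothesis HG : qgroup w D A G.
Let w0 := qg_ge0 HG.
Let Glin := qg_lin HG.

Lemma qg_tends s (u : nat -> X) l : tends u l -> tends (fun n => G s (u n)) (G s l).
Proof. exact: tends_lin (Glin s) (qg_bound HG s). Qed.

(** If M < |A y|, the Lipschitz bound with constant M fails strictly at some h. The failure persists
    along u n, so [group_lipschitz] forces M <= |A (u n)|. *)
Lemma gen_lsc_near (u : nat -> X) y (e : R) : tends u y ->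
  (\forall n \near \oo, D (u n)) -> D y -> 0 < e ->
  \forall n \near \oo, rnorm (A y) <= rnorm (A (u n)) + e.
Proof.
move=> uy Du Dy e0; pose M := rnorm (A y) - e.
have [M0|M0] := ltP M 0.
  by near=> n; have := rnorm_ge0 (A (u n)); move: M0; rewrite /M; lra.
have [h hh] : exists h, `|h| * expR (w * `|h|) * M < rnorm (G h y - y).
  apply: contrapT => /forallNP hN.
  suff : rnorm (A y) <= M by rewrite /M; lra.
  apply: (@rderiv_bound _ _ w G y _ M M0) (qg_gen HG Dy) => h.
  by rewrite leNgt; apply/negP.
have h0 : 0 < `|h|.
  rewrite normr_gt0; apply/eqP => h0; move: hh.
  by rewrite h0 (qg_0 HG) subrr rnorm0 normr0 !mul0r ltxx.
pose E := `|h| * expR (w * `|h|); have E0 : 0 < E by rewrite mulr_gt0 ?expR_gt0.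
have vy : tends (fun n => G h (u n) - u n) (G h y - y).
  by apply: tendsD; [exact: qg_tends|exact: tendsN].
near=> n.
have Dun : D (u n) by near: n.
have h1 : rnorm (G h (u n) - u n - (G h y - y)) <= rnorm (G h y - y) - E * M.
  by near: n; apply: vy; rewrite subr_gt0.
suff : M <= rnorm (A (u n)) by rewrite /M; lra.
rewrite -(ler_pM2l E0); apply: le_trans (group_lipschitz HG h Dun).
have := lerB_rnorm (G h y - y) (G h (u n) - u n); rewrite rnormC; lra.
Unshelve. all: by end_near.
Qed.

Lemma gen_lsc (u : nat -> X) y (M : R) : tends u y ->
  (\forall n \near \oo, D (u n) /\ rnorm (A (u n)) <= M) -> D y ->
  rnorm (A y) <= M.
Proof.
move=> uy hu Dy; apply/ler_addgt0Pr => e e0; near \oo => n.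
have [_ Aun] : D (u n) /\ rnorm (A (u n)) <= M by near: n.
have : rnorm (A y) <= rnorm (A (u n)) + e.
  by near: n; apply: gen_lsc_near => //; apply: filterS hu => n [].
by move=> /le_trans; apply; rewrite lerD2r.
Unshelve. all: by end_near.
Qed.

Lemma dyq_tends m (u : nat -> X) l : tends u l -> tends (fun n => dyq G m (u n)) (dyq G m l).
Proof.
move=> ul; apply: tendsZ; apply: tendsD; first exact: qg_tends.
exact: tendsN.
Qed.

(** For fixed n, [avg k n x] tends to the mean of the orbit over [0, 2^-n]. This mean is near x and
    has derivative [dyq G n x]: its m-th quotient is a limit of averages of the orbit of that vector
    over [0, 2^-m]. *)
Lemma qg_dense x (e : R) : 0 < e -> exists2 y, D y & rnorm (y - x) <= e.
Proof.
move=> e0; have [n hn] := group_small HG x e0.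
have bound1 k m z : rnorm (avg G k m z) <= expR w * rnorm z.
  apply: le_trans (avg_bound HG _ _ _) _.
  by rewrite ler_wpM2r ?rnorm_ge0// ler_expR ler_piMr// dy_le1.
have cau (eta : R) : 0 < eta -> exists N : nat, forall k m : nat, (N <= k)%N -> (k <= m)%N ->
    rnorm (avg G m n x - avg G k n x) <= eta.
  move=> eta0; have [N hN] := group_small HG x (divr_gt0 eta0 (expR_gt0 w)).
  exists N => k m Nk km; rewrite -(subnKC km) (avg_comp HG).
  rewrite -(linsub (avg_lin HG _ _)); apply: le_trans (bound1 _ _ _) _.
  rewrite mulrC -ler_pdivlMr ?expR_gt0//; apply: (avg_hull HG) => s s0 sn.
  by apply: hN => //; apply: le_trans sn _; apply: dy_le; rewrite (leq_trans Nk)// leq_addl.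
have [l ul] := rcauchy_cvg cau.
exists l; last first.
  by apply: tends_le ul _; near=> k; exact: (avg_hull HG).
apply: (qg_dom HG (v := dyq G n x)); apply: (rderiv_dyadic HG) => eta eta0.
have [N hN] := group_small HG (dyq G n x) eta0.
near=> m; apply: tends_le (dyq_tends m ul) _; near=> k.
have mn : (n <= m)%N by near: m; exact: nbhs_infty_ge.
have mN : (N <= m)%N by near: m; exact: nbhs_infty_ge.
have mk : (m <= n + k)%N.
  by rewrite (leq_trans _ (leq_addl _ _))//; near: k; exact: nbhs_infty_ge.
rewrite (dyq_avg HG (n + k - m) m) subnKC// -(avg_dyq HG) -(dyq_avg HG).
apply: (avg_hull HG) => s s0 sm; apply: hN => //.
by apply: le_trans sm _; exact: dy_le.
Unshelve. all: by end_near.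
Qed.

Hypothesis UC : uniformly_convex X.

(* Substitute for reflexivity.  Put z_n = dyq n y and let M_n be the average of
   the orbit over [0, 2^-n]: then M_n z_m = z_n and, for large l, M_n z_l is close
   to z_n, so (z_l + z_m)/2 is nearly as long as the longest z_n. *)
Lemma dyq_bounded_dom y (M : R) : (forall n, rnorm (dyq G n y) <= M) -> D y.
Proof.
move=> hM.
pose b n := rnorm (dyq G n y).
(* Averaging over [0, 2^-n] stretches norms by up to [expR (w * dy n)]. With the weight, each
   element of [S] bounds all later [b] from below, while [L] bounds them from above up to a factor
   tending to 1. *)
pose S := [set expR (- (w * dy n)) * b n | n in [set: nat]].
have wd n : 0 <= w * dy n by rewrite mulr_ge0// ltW// dy_gt0.
have Sub : has_ubound S.
  exists M => _ [n _ <-]; apply: le_trans (hM n).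
  by rewrite ler_piMl ?rnorm_ge0// -expR0 ler_expR oppr_le0.
have Ssup : has_sup S by split => //; exists (expR (- (w * dy 0)) * b 0); exists 0.
pose L := sup S.
have bL n : b n <= expR (w * dy n) * L.
  rewrite mulrC -ler_pdivrMr ?expR_gt0// -expRN mulrC.
  by apply: ub_le_sup => //; exists n.
have bmono n k : expR (- (w * dy n)) * b n <= b (n + k)%N.
  rewrite mulrC expRN ler_pdivrMr ?expR_gt0// mulrC /b (dyq_avg HG k).
  exact: (avg_bound HG).
suff [v hv] : exists v, tends (dyq G ^~ y) v.
  by apply: (qg_dom HG (v := v)); exact: (rderiv_dyadic HG).
have L0 : 0 <= L.
  apply: (@le_trans _ _ (expR (- (w * dy 0)) * b 0)).
    by rewrite mulr_ge0 ?expR_ge0 ?rnorm_ge0.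
  by apply: ub_le_sup => //; exists 0.
move: L0; rewrite le_eqVlt => /orP[/eqP L0|L0].
  exists 0 => e e0; near=> n; rewrite subr0 (le_trans (bL n))// -L0 mulr0 ltW//.
apply: rcauchy_cvg => eps eps0.
have [d0 d00 hd0] := uniformly_convex_scaled UC L0 eps0.
pose d := Num.min d0 1; have dpos : 0 < d by rewrite lt_min d00 /=.
have dd0 : d <= d0 by rewrite ge_min lexx.
have d1 : d <= 1 by rewrite ge_min lexx orbT.
(* The distance to the supremum, the stretching by averages and the oscillation of the orbit of z_n1
   are each held to relative size d/4, which together stays below d. *)
have d40 : 0 < d / 4 by rewrite divr_gt0.
have [_ [n0 _ <-] hn0] := sup_adherent (mulr_gt0 L0 d40) Ssup.
rewrite -/L in hn0.
have [n1 n01 E1] : exists2 n1 : nat, (n0 <= n1)%N & forall n, (n1 <= n)%N ->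
    expR (w * dy n) <= 1 + d / 4.
  have : \forall h \near (0 : R), expR (w * h) < 1 + d / 4.
    have : expR (w * h) @[h --> (0:R)] --> expR (w * 0).
      apply: continuous_cvg; first exact: continuous_expR.
      by apply: cvgMr; exact: cvg_id.
    by move/cvgr_lt; apply; rewrite mulr0 expR0 ltrDl.
  move=> /nbhs_ballP[r /= r0 hr].
  have [n1 hn1] := dy_small (divr_gt0 r0 (ltr0Sn R 1)).
  exists (maxn n0 n1); first exact: leq_maxl.
  move=> n; rewrite geq_max => /andP[_ n1n]; apply/ltW/hr.
  rewrite /ball/= sub0r normrN gtr0_norm ?dy_gt0//.
  apply: le_lt_trans (dy_le n1n) _; apply: le_lt_trans hn1 _.
  by rewrite ltr_pdivrMr// ltr_pMr// ltr1n.
have blow n : (n0 <= n)%N -> L * (1 - d / 4) <= b n.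
  by move=> nn; have := bmono n0 (n - n0)%N; rewrite subnKC//; lra.
have [l0 hl0] := group_small HG (dyq G n1 y) (mulr_gt0 L0 d40).
exists (maxn l0 n1) => l m; rewrite geq_max => /andP[l0l n1l] lm.
have n1m := leq_trans n1l lm.
have up n : (n1 <= n)%N -> rnorm (dyq G n y) <= L * (1 + d0).
  move=> nn; apply: le_trans (bL n) _; rewrite mulrC ler_pM2l//.
  by apply: le_trans (E1 n nn) _; lra.
rewrite rnormC; apply: hd0; [exact: up|exact: up|].
set a := _ *:r _.
(* Averages commute: averaging over [0, 2^-n1] turns z_m into z_n1 and z_l into an average of the
   orbit of z_n1 over the short interval [0, 2^-l]. *)
have avga : avg G (m - n1) n1 a =
    2^-1 *:r (avg G (m - l) l (dyq G n1 y) + dyq G n1 y).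
  rewrite /a (linZ (avg_lin HG _ _)) (linD (avg_lin HG _ _)); congr (_ *:r (_ + _)).
    rewrite (dyq_avg HG (m - l) l) subnKC// (avg_comm HG).
    by rewrite (dyq_avg HG (m - n1) n1) subnKC.
  by rewrite [in RHS](dyq_avg HG (m - n1) n1) subnKC.
have h1 : rnorm (avg G (m - l) l (dyq G n1 y) - dyq G n1 y) <= L * (d / 4).
  apply: (avg_hull HG) => s s0 sl; apply: hl0 => //.
  by apply: le_trans sl _; exact: dy_le.
have h2 : b n1 <= rnorm (avg G (m - n1) n1 a) + L * (d / 4) / 2.
  rewrite avga; have -> : b n1 = rnorm (2^-1 *:r (avg G (m - l) l (dyq G n1 y) + dyq G n1 y) - 2^-1 *:r (avg G (m - l) l (dyq G n1 y) - dyq G n1 y)).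
    rewrite -scalerBr (_ : _ - (_ - _) = dyq G n1 y + dyq G n1 y); last by zmod.
    by rewrite scalerDr rscaler_half.
  apply: le_trans (ler_rnormB _ _) _; rewrite lerD2l rnormZ ger0_norm ?invr_ge0// mulrC.
  by rewrite ler_pM2r.
have h3 := avg_bound HG (m - n1) n1 a.
have h4 := E1 n1 (leqnn _).
have h5 := blow n1 n01.
have a0 := rnorm_ge0 a.
have h6 : expR (w * dy n1) * rnorm a <= (1 + d / 4) * rnorm a by rewrite ler_wpM2r.
have Ld : 0 < L * d by rewrite mulr_gt0.
rewrite leNgt; apply/negP => ha.
have h7 : (1 + d / 4) * rnorm a <= (1 + d / 4) * (L * (1 - d)).
  rewrite ler_pM2l; last lra.
  by apply: le_trans (ltW ha) _; rewrite ler_pM2l//; lra.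
have : 0 <= L * d * d by rewrite !mulr_ge0// ltW.
move: h2 h3 h5 h6 h7 Ld; lra.
Unshelve. all: by end_near.
Qed.

(** The common Lipschitz bound of the orbits of u n passes to the limit as a bound on the quotients
    of y, and [dyq_bounded_dom] applies. *)
Lemma tends_dom (u : nat -> X) y (M : R) : tends u y ->
  (\forall n \near \oo, D (u n) /\ rnorm (A (u n)) <= M) ->
  D y /\ rnorm (A y) <= M.
Proof.
move=> uy hu; suff Dy : D y by split => //; exact: gen_lsc uy hu Dy.
apply: (@dyq_bounded_dom y (expR w * M)) => n.
rewrite -[dyq G n y]subr0; apply: tends_le (dyq_tends n uy) _; near=> j.
have [Du Au] : D (u j) /\ rnorm (A (u j)) <= M by near: j.
rewrite subr0 rnormZ ger0_norm ?exprn_ge0//.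
have := group_lipschitz HG (dy n) Du; rewrite gtr0_norm ?dy_gt0// => H.
rewrite -(ler_pM2l (dy_gt0 n)) mulrA /dy -exprMn mulVf// expr1n mul1r.
apply: le_trans H _; rewrite -mulrA ler_pM2l ?dy_gt0//.
by rewrite ler_pM ?expR_ge0 ?rnorm_ge0// ler_expR ler_piMr// dy_le1.
Unshelve. all: by end_near.
Qed.

Lemma gen_closed (u : nat -> X) y z : (forall n, D (u n)) -> tends u y ->
  tends (A \o u) z -> D y /\ A y = z.
Proof.
move=> Du uy Auz; have [Dy _] : D y /\ rnorm (A y) <= rnorm z + 1.
  apply: tends_dom uy _; near=> n; split => //.
  have : rnorm (A (u n) - z) <= 1 by near: n; exact: Auz.
  by have := lerB_rnorm (A (u n)) z; lra.
split=> //; apply: (@tends_unique _ _ (A \o u)) (Auz) => e e0.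
have e20 : 0 < e / 2 by rewrite divr_gt0.
have [N _ hN] := Auz _ e20; exists N => // n /= Nn.
(* Semicontinuity along m of u m - u n, with n fixed, bounds A y - A (u n). *)
rewrite rnormC -(genB HG)//; apply: (gen_lsc (u := fun m => u m - u n)).
- by apply: tendsD uy _; apply: tends_cst.
- exists N => // m /= Nm; split; first exact: (domB HG).
  rewrite (genB HG)//; have := ler_rdistD z (A (u m)) (A (u n)).
  have := hN m Nm; have := hN n Nn; rewrite /= (rnormC z); lra.
- exact: (domB HG).
Unshelve. all: by end_near.
Qed.

(* Kadec-Klee property of the graph norm. *)
Lemma gen_tends (u : nat -> X) y : (forall n, D (u n)) -> D y -> tends u y ->
  (forall e : R, 0 < e -> \forall n \near \oo, rnorm (A (u n)) <= rnorm (A y) + e) ->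
  tends (A \o u) (A y).
Proof.
move=> Du Dy uy hu e e0.
have := rnorm_ge0 (A y); rewrite le_eqVlt => /orP[/eqP L0|L0].
  have Ay0 : A y = 0 by apply: rnorm_eq0.
  by apply: filterS (hu _ e0) => n /=; rewrite Ay0 subr0 rnorm0 add0r.
have [d d0 hd] := uniformly_convex_scaled UC L0 e0.
have d'0 : 0 < rnorm (A y) * d by rewrite mulr_gt0.
(* The midpoints of u n and y also tend to y, so semicontinuity keeps their images long; no weak
   convergence is involved. *)
have H : \forall n \near \oo, rnorm (A y) * (1 - d) <= rnorm (2^-1 *:r (A (u n) + A y)).
  pose v n := 2^-1 *:r (u n + y).
  have vy : tends v y.
    rewrite -[y](rscaler_half y) -scalerDr; apply: tendsZ.
    by apply: tendsD => //; exact: tends_cst.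
  have Dv n : D (v n) by apply: (domZ HG); exact: (domD HG).
  apply: filterS (gen_lsc_near vy (nearW _ Dv) Dy d'0) => n.
  by rewrite /v (genZ HG) ?(genD HG)//; [lra|exact: (domD HG)].
near=> n; apply: hd.
- rewrite mulrDr mulr1; near: n; exact: hu.
- by rewrite mulrDr mulr1 lerDl ltW.
- by near: n.
Unshelve. all: by end_near.
Qed.

End Generator.

(** * Equivalence of the graph norms *)

Section ClosedGraph.
Context {R : realType} {X : completeNormedModType R[i]}.
Variables (w : R) (D : set X) (A1 A2 : X -> X) (G1 G2 : R -> X -> X).
Hypothesis HG1 : qgroup w D A1 G1.
Hypothesis HG2 : qgroup w D A2 G2.
Hypothesis UC : uniformly_convex X.

Lemma dyq_bound k y : D y -> rnorm (dyq G1 k y) <= expR w * rnorm (A1 y).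
Proof.
move=> Dy; have := group_lipschitz HG1 (dy k) Dy.
rewrite -dyqK rnormZ gtr0_norm ?dy_gt0// -mulrA ler_pM2l ?dy_gt0// => /le_trans; apply.
rewrite ler_wpM2r ?rnorm_ge0// ler_expR ler_piMr ?dy_le1//; exact: qg_ge0 HG1.
Qed.

Lemma dyq_lin k : lin (dyq G1 k).
Proof.
move=> a x y; rewrite /dyq (qg_lin HG1).
have -> : a *: G1 (dy k) x + G1 (dy k) y - (a *: x + y) =
  a *: (G1 (dy k) x - x) + (G1 (dy k) y - y) by rewrite scalerBr; zmod.
by rewrite scalerDr !scalerA mulrC.
Qed.

Lemma dyq_gen y : D y -> tends (dyq G1 ^~ y) (A1 y).
Proof.
move=> /(qg_gen HG1) hy e e0; have [d d0 hd] := hy e e0.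
have d20 : 0 < d / 2 by rewrite divr_gt0.
apply: filterS (near_dy d20) => n hn.
have dn : 0 < dy n :> R by exact: dy_gt0.
have := hd (dy n); rewrite gtr0_norm// -dyqK -scalerBr rnormZ gtr0_norm// mulrC.
by rewrite ler_pM2r//; apply; lra.
Qed.

Lemma graph_norm_ge0 (B : X -> X) y : 0 <= graph_norm B y.
Proof. by rewrite addr_ge0 ?rnorm_ge0. Qed.

Let unbounded := forall C : R, exists2 y, D y & C * graph_norm A2 y < rnorm (A1 y).

(** One of y + u and y - u has a large k-th quotient, since the two quotients differ by twice that
    of u. The quotient is Lipschitz on X with constant [c], so it stays large on a ball of radius
    1/c. *)
Let ball_step (i : nat) y (r : R) : unbounded -> D y -> 0 < r ->
  exists p : X * R, [/\ D p.1, 0 < p.2, p.2 <= r / 2, graph_norm A2 (p.1 - y) <= r / 2 &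
    forall z, D z -> graph_norm A2 (z - p.1) <= p.2 ->
      exists k, i%:R <= rnorm (dyq G1 k z)].
Proof.
(* After rescaling u0 to graph norm r/2 its image exceeds i + 2; one unit is lost in passing to a
   quotient, another on the ball. *)
move=> unb Dy r0; have [u0 Du0 hu0] := unb (2 * (i%:R + 2) / r).
have i0 : 0 <= i%:R :> R by [].
have nu0 : 0 < graph_norm A2 u0.
  rewrite lt_neqAle graph_norm_ge0 andbT; apply/eqP => n0.
  have u00 : u0 = 0.
    apply: rnorm_eq0; move: n0 (rnorm_ge0 u0) (rnorm_ge0 (A2 u0)).
    by rewrite /graph_norm; lra.
  by move: hu0; rewrite u00 (gen0 HG1) rnorm0 -u00 -n0 mulr0 ltxx.
pose a := r / 2 / graph_norm A2 u0; have a0 : 0 < a by rewrite !divr_gt0.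
pose u := a *:r u0; have Du : D u by exact: (domZ HG1).
have nu : graph_norm A2 u = r / 2.
  rewrite /graph_norm /u (genZ HG2)// !rnormZ gtr0_norm// -mulrDr.
  by rewrite -/(graph_norm A2 u0) divfK// gt_eqF.
have Au : i%:R + 2 < rnorm (A1 u).
  rewrite /u (genZ HG1)// rnormZ gtr0_norm//.
  have -> : i%:R + 2 = a * (2 * (i%:R + 2) / r * graph_norm A2 u0).
    by rewrite /a; field; rewrite !gt_eqF.
  by rewrite ltr_pM2l.
have [k hk] : exists k, i%:R + 1 <= rnorm (dyq G1 k u).
  have [k _ hk] := dyq_gen Du ltr01; exists k.
  have := hk k (leqnn k); have := lerB_rnorm (A1 u) (dyq G1 k u).
  rewrite /= (rnormC (A1 u)); lra.
have [y' [Dy' ny' hy']] : exists y', [/\ D y', graph_norm A2 (y' - y) <= r / 2 &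
    i%:R + 1 <= rnorm (dyq G1 k y')].
  have [h|h] := leP (i%:R + 1) (rnorm (dyq G1 k (y + u))).
    exists (y + u); split => //; first exact: (domD HG1).
    by rewrite (_ : y + u - y = u) ?nu//; zmod.
  exists (y - u); split => //; first exact: (domB HG1).
    rewrite (_ : y - u - y = - u); last by zmod.
    rewrite -nu /graph_norm rnormN -[- u]add0r (genB HG2)//; last exact: (dom0 HG2).
    by rewrite (gen0 HG2) add0r rnormN.
  have : rnorm (2 *:r dyq G1 k u) <= rnorm (dyq G1 k (y + u)) + rnorm (dyq G1 k (y - u)).
    apply: le_trans (ler_rnormB _ _).
    rewrite (linD (dyq_lin k)) (linsub (dyq_lin k)).
    rewrite (_ : _ - _ = dyq G1 k u + dyq G1 k u); last by zmod.
    by rewrite (_ : 2 = 1 + 1 :> R) ?rscalerDl ?rscale1r.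
  rewrite rnormZ ger0_norm//; lra.
pose c : R := 2 ^+ k * (expR (w * dy k) + 1).
have c0 : 0 < c by rewrite mulr_gt0 ?exprn_gt0// addr_gt0 ?expR_gt0.
have hc x : rnorm (dyq G1 k x) <= c * rnorm x.
  rewrite rnormZ gtr0_norm ?exprn_gt0// /c -mulrA ler_pM2l ?exprn_gt0// mulrDl mul1r.
  apply: le_trans (ler_rnormB _ _) _; rewrite lerD2r.
  by apply: (qg_bound_le HG1); rewrite gtr0_norm// dy_gt0.
exists (y', Num.min (r / 2) c^-1) => /=; split=> //.
- by rewrite lt_min divr_gt0//= invr_gt0.
- by rewrite ge_min lexx.
move=> z Dz; rewrite le_min => /andP[_ hz]; exists k.
have h1 : rnorm (z - y') <= c^-1.
  by apply: le_trans hz; rewrite /graph_norm lerDl rnorm_ge0.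
have : rnorm (dyq G1 k (y' - z)) <= 1.
  apply: le_trans (hc _) _; rewrite rnormC -(mulfV (lt0r_neq0 c0)).
  by rewrite ler_pM2l.
rewrite (linsub (dyq_lin k)).
have := lerB_rnorm (dyq G1 k y') (dyq G1 k z); lra.
Qed.

(* Closed graph theorem, by the nested balls argument on D with the graph norm
   of A2 and the difference quotients of G1. *)
Lemma graph_norm_dominated :
  exists2 C : R, 0 <= C & forall y, D y -> rnorm (A1 y) <= C * graph_norm A2 y.
Proof.
apply: contrapT => hN.
have unb : unbounded.
  move=> C; apply: contrapT => /forall2NP hC; apply: hN.
  exists `|C| => // y Dy; have [//|/negP] := hC y; rewrite -leNgt => /le_trans; apply.
  by rewrite ler_wpM2r ?graph_norm_ge0// ler_norm.
pose st := {p : X * R | D p.1 /\ 0 < p.2}.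
have [f hf] : exists f : nat -> st -> st, forall i (p : st),
    [/\ (sval (f i p)).2 <= (sval p).2 / 2,
        graph_norm A2 ((sval (f i p)).1 - (sval p).1) <= (sval p).2 / 2 &
    forall z, D z -> graph_norm A2 (z - (sval (f i p)).1) <= (sval (f i p)).2 ->
      exists k, i%:R <= rnorm (dyq G1 k z)].
  suff /choice[f hf] : forall ip : nat * st, exists q : st,
    [/\ (sval q).2 <= (sval ip.2).2 / 2,
        graph_norm A2 ((sval q).1 - (sval ip.2).1) <= (sval ip.2).2 / 2 &
    forall z, D z -> graph_norm A2 (z - (sval q).1) <= (sval q).2 ->
      exists k, ip.1%:R <= rnorm (dyq G1 k z)].
    by exists (fun i p => f (i, p)) => i p; exact: hf (i, p).
  move=> [i [[y r] [/= Dy r0]]] /=.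
  have [q [Dq q0 h1 h2 h3]] := ball_step i unb Dy r0.
  by exists (exist _ q (conj Dq q0)).
have D0 : D 0 /\ 0 < 1 :> R by split => //; exact: (dom0 HG1).
pose s := fix s (n : nat) : st :=
  if n is m.+1 then f m (s m) else exist _ (0 : X, 1 : R) D0.
pose y n := (sval (s n)).1; pose r n := (sval (s n)).2.
have Dy n : D (y n) by have [] := svalP (s n).
have r0 n : 0 < r n by have [] := svalP (s n).
have rS n : r n.+1 <= r n / 2 by have [] := hf n (s n).
have yS n : graph_norm A2 (y n.+1 - y n) <= r n / 2 by have [] := hf n (s n).
have nD a b c : D a -> D b -> D c ->
    graph_norm A2 (a - c) <= graph_norm A2 (a - b) + graph_norm A2 (b - c).
  move=> Da Db Dc; rewrite /graph_norm !(genB HG2)//.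
  have := ler_rdistD b a c; have := ler_rdistD (A2 b) (A2 a) (A2 c); lra.
have yD n m : graph_norm A2 (y (n + m)%N - y n) <= r n.
  elim: m n => [|m IH] n.
    by rewrite addn0 subrr /graph_norm rnorm0 (gen0 HG2) rnorm0 addr0 ltW.
  apply: le_trans (nD _ (y n.+1) _ _ _ _) _ => //; rewrite -addSnnS.
  have := IH n.+1; have := yS n; have := rS n; lra.
have rdy n : r n <= dy n.
  elim: n => [|n IH]; first by rewrite /r/= /dy expr0.
  by apply: le_trans (rS n) _; rewrite /dy exprS mulrC; rewrite ler_pM2l.
have cau (v : nat -> X) : (forall n m, rnorm (v m - v n) <= graph_norm A2 (y m - y n)) ->
    exists l, tends v l.
  move=> hv; apply: rcauchy_cvg => e e0; have [N hN'] := dy_small e0.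
  exists N => m n Nm mn; apply: le_trans (hv _ _) _; rewrite -(subnKC mn).
  apply: le_trans (yD _ _) _; apply: le_trans (rdy m) _.
  by apply: le_trans (dy_le Nm) hN'.
have [l yl] : exists l, tends y l.
  by apply: cau => n m; rewrite lerDl rnorm_ge0.
have [z Ayz] : exists z, tends (A2 \o y) z.
  by apply: cau => n m; rewrite /= -(genB HG2)// lerDr rnorm_ge0.
have [Dl Al] := gen_closed HG2 UC Dy yl Ayz.
have ln n : graph_norm A2 (l - y n) <= r n.
  apply/ler_addgt0Pr => e e0; near \oo => m.
  have nm : (n <= m)%N by near: m; exact: nbhs_infty_ge.
  have h1 : rnorm (y m - l) <= e / 2 by near: m; apply: yl; rewrite divr_gt0.
  have h2 : rnorm (A2 (y m) - z) <= e / 2 by near: m; apply: Ayz; rewrite divr_gt0.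
  apply: le_trans (nD _ (y m) _ _ _ _) _ => //.
  have := yD n (m - n)%N; rewrite subnKC//.
  have : graph_norm A2 (l - y m) <= e.
    rewrite /graph_norm (genB HG2)// Al.
    have := rnormC l (y m); have := rnormC z (A2 (y m)); lra.
  lra.
(* The ball of index N.+1 is the one built with threshold N, and l lies in it: this contradicts the
   bound on the quotients of l from [dyq_bound]. *)
pose N := (Num.truncn (expR w * rnorm (A1 l))).+1.
have [k hk] : exists k, N%:R <= rnorm (dyq G1 k l).
  by have [_ _] := hf N (s N); apply => //; exact: (ln N.+1).
have := le_trans hk (dyq_bound k Dl); apply/negP; rewrite -ltNge.
by apply: truncnS_gt.
Unshelve. all: by end_near.
Qed.

End ClosedGraph.

(** * A continuous control function for the variation of A *)

Section ControlFunction.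
Context {R : realType}.
Variables (T M : R) (kappa : R -> R -> R).
Hypothesis T0 : 0 < T.

Fixpoint chain_sum (a : R) (s : seq R) : R :=
  if s is x :: s' then kappa a x + chain_sum x s' else 0.

Hypothesis kappa_ge0 : forall a b, 0 <= a -> a <= b -> b <= T -> 0 <= kappa a b.
Hypothesis kappa_triangle : forall a t b, 0 <= a -> a <= t -> t <= b -> b <= T ->
  kappa a b <= kappa a t + kappa t b.
Hypothesis chain_sum_le : forall s, itv_partition 0 T s -> chain_sum 0 s <= M.
Hypothesis kappa_small : forall t, 0 <= t -> t <= T -> forall e, 0 < e ->
  exists2 d : R, 0 < d & forall s, 0 <= s -> s <= T -> `|s - t| < d ->
    kappa s t <= e /\ kappa t s <= e.

Lemma chain_sum_cat a s1 s2 :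
  chain_sum a (s1 ++ s2) = chain_sum a s1 + chain_sum (last a s1) s2.
Proof. by elim: s1 a => [|x s1 IH] a /=; rewrite ?add0r// IH addrA. Qed.

Let partition_cons (a b x : R) s : itv_partition a b (x :: s) ->
  [/\ a < x, x <= b & itv_partition x b s].
Proof.
move=> h; have h' := itv_partition_cons h; split => //; last exact: itv_partition_le h'.
by case: h => /= /andP[].
Qed.

(** Inserting t in the partition does not decrease the sum, by the triangle inequality in the cell
    containing t. *)
Lemma chain_sum_split a t b s : 0 <= a -> b <= T -> a < t -> t < b ->
  itv_partition a b s -> exists s1 s2,
  [/\ itv_partition a t s1, itv_partition t b s2 &
      chain_sum a s <= chain_sum a s1 + chain_sum t s2].
Proof.
move=> + bT + tb; elim: s a => [|x s IH] a a0 at_.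
  by move=> [_ /eqP/= ab]; move: (lt_trans at_ tb); rewrite ab ltxx.
move=> /partition_cons[ax xb xs]; have [tx|xt|tx] := ltgtP t x.
- exists [:: t], (x :: s); split.
  + by split => //=; rewrite at_.
  + by split => /=; [rewrite tx; case: xs|case: xs].
  + rewrite /= addr0 addrA lerD2r.
    by apply: kappa_triangle; [|exact: ltW|exact: ltW|exact: le_trans bT].
- have [s1 [s2 [h1 h2 h3]]] := IH x (le_trans a0 (ltW ax)) xt xs.
  exists (x :: s1), s2; split => //; last by rewrite /= -addrA lerD2l.
  by case: h1 => h1 h1'; split => //=; rewrite ax.
- exists [:: x], s; rewrite tx; split => //; last by rewrite /= addr0.
  by split => //=; rewrite ax.
Qed.

Let S (t : R) := [set chain_sum 0 s | s in itv_partition 0 t].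
Let v0 (t : R) := sup (S t).

Let S_ne t : 0 <= t -> S t !=set0.
Proof.
rewrite le_eqVlt => /orP[/eqP <-|t0]; first by exists 0; exists [::].
by exists (chain_sum 0 [:: t]); exists [:: t] => //; split => //=; rewrite t0.
Qed.

Let S_ub t : 0 <= t -> t <= T -> has_ubound (S t).
Proof.
move=> t0; rewrite le_eqVlt => /orP[/eqP ->|tT].
  by exists M => _ [s hs <-]; exact: chain_sum_le.
exists M => _ [s hs <-]; apply: le_trans (_ : chain_sum 0 (s ++ [:: T]) <= _).
  by rewrite chain_sum_cat lerDl /= addr0; case: hs => _ /eqP ->; rewrite kappa_ge0// ltW.
by apply: chain_sum_le; apply: itv_partition_cat hs _; split => //=; rewrite tT.
Qed.

Let S_sup t : 0 <= t -> t <= T -> has_sup (S t).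
Proof. by move=> t0 tT; split; [exact: S_ne|exact: S_ub]. Qed.

Let v0_add a b s : 0 <= a -> a <= b -> b <= T -> itv_partition a b s ->
  v0 a + chain_sum a s <= v0 b.
Proof.
move=> a0 ab bT hs; rewrite -lerBrDr; apply: ge_sup; first exact: S_ne.
move=> _ [r hr <-]; rewrite lerBrDr.
have -> : chain_sum a s = chain_sum (last 0 r) s by case: hr => _ /eqP ->.
rewrite -chain_sum_cat; apply: ub_le_sup; first by apply: S_ub => //; exact: le_trans ab.
by exists (r ++ s) => //; exact: itv_partition_cat hr hs.
Qed.

Let v0_kappa a b : 0 <= a -> a < b -> b <= T -> kappa a b <= v0 b - v0 a.
Proof.
move=> a0 ab bT; rewrite lerBrDl.
have /(v0_add a0 (ltW ab) bT) : itv_partition a b [:: b] by split => //=; rewrite ab.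
by rewrite /= addr0.
Qed.

Let v0_mono a b : 0 <= a -> a <= b -> b <= T -> v0 a <= v0 b.
Proof.
move=> a0; rewrite [a <= b]le_eqVlt => /orP[/eqP ->//|ab] bT.
by rewrite -subr_ge0; apply: le_trans (v0_kappa a0 ab bT); rewrite kappa_ge0// ltW.
Qed.

(** In a nearly optimal partition of [0, t], moving the last point t back to s within the last cell
    loses only [kappa s t], which is small. *)
Let v0_left t (e : R) : 0 <= t -> t <= T -> 0 < e ->
  exists2 d : R, 0 < d & forall s, 0 <= s -> s <= t -> t - s < d -> v0 t - v0 s <= e.
Proof.
rewrite [0 <= t]le_eqVlt => /orP[/eqP <- _ e0|t0 tT e0].
  exists 1 => // s s0 s0' _; rewrite (_ : s = 0) ?subrr ?ltW//.
  by apply/eqP; rewrite eq_le s0 s0'.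
have e20 : 0 < e / 2 by rewrite divr_gt0.
have [_ [r hr <-] hv] := sup_adherent e20 (S_sup (ltW t0) tT).
have [d d0 hd] := kappa_small (ltW t0) tT e20.
case/lastP: r hr hv => [|r x] hr hv.
  by move: t0; rewrite (itv_partition_nil hr) ltxx.
have [hp /eqP] := hr; rewrite last_rcons => xt; rewrite {}xt {x} in hr hp hv.
move: hp; rewrite rcons_path => /andP[hp pt].
set p := last 0 r in pt.
have h1 : itv_partition 0 p r by split.
have p0 := itv_partition_le h1.
exists (Num.min d (t - p)); first by rewrite lt_min d0 subr_gt0.
move=> s s0; rewrite [s <= t]le_eqVlt => /orP[/eqP -> _|st]; first by rewrite subrr ltW.
rewrite lt_min => /andP[sd sp]; have ps : p < s by lra.
have sT : s <= T by rewrite (le_trans (ltW st)).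
have h2 := itv_partition_cat h1 (itv_partition1 ps).
have := v0_add (lexx _) s0 sT h2.
have [k1 _] : kappa s t <= e / 2 /\ kappa t s <= e / 2.
  by apply: hd => //; rewrite ltr0_norm ?subr_lt0// opprB.
have k2 := kappa_triangle p0 (ltW ps) (ltW st) tT.
have : 0 <= v0 0 by apply: ub_le_sup; [apply: S_ub => //; exact: ltW|exists [::]].
move: hv; rewrite -cats1 !chain_sum_cat /= -/p !addr0 -/(v0 t); lra.
Qed.

(** A nearly optimal partition of all of [0, T] is cut at t, because variation to the right of t is
    at stake. For s before the next partition point, the variation over [t, s] exceeds [kappa t s]
    by no more than the defect of that partition. *)
Let v0_right t (e : R) : 0 <= t -> t <= T -> 0 < e ->
  exists2 d : R, 0 < d & forall s, t <= s -> s <= T -> s - t < d -> v0 s - v0 t <= e.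
Proof.
move=> t0; rewrite [t <= T]le_eqVlt => /orP[/eqP -> e0|tT e0].
  exists 1 => // s s0 s0' _; rewrite (_ : s = T) ?subrr ?ltW//.
  by apply/eqP; rewrite eq_le s0 s0'.
have e20 : 0 < e / 2 by rewrite divr_gt0.
have [_ [r hr <-] hv] := sup_adherent e20 (S_sup (ltW T0) (lexx T)).
have [d d0 hd] := kappa_small t0 (ltW tT) e20.
have [s1 [s2 [h1 h2 h12]]] : exists s1 s2,
    [/\ itv_partition 0 t s1, itv_partition t T s2 &
      chain_sum 0 r <= chain_sum 0 s1 + chain_sum t s2].
  move: (t0); rewrite le_eqVlt => /orP[/eqP <-|t0']; last exact: chain_sum_split hr.
  by exists [::], r; split => //=; rewrite add0r.
case: s2 h2 h12 => [|q s2] h2 h12.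
  by move: tT; rewrite (itv_partition_nil h2) ltxx.
have [tq qT h3] := partition_cons h2.
exists (Num.min d (q - t)); first by rewrite lt_min d0 subr_gt0.
move=> s; rewrite [t <= s]le_eqVlt => /orP[/eqP <- _ _|ts]; first by rewrite subrr ltW.
move=> sT; rewrite lt_min => /andP[sd sp]; have sq : s < q by lra.
have s0 : 0 <= s by rewrite (le_trans t0)// ltW.
have h4 : itv_partition s T (q :: s2).
  by case: h3 => h3 h3'; split => //=; rewrite sq.
have /= := v0_add s0 sT (lexx T) h4.
have [_ k1] : kappa s t <= e / 2 /\ kappa t s <= e / 2.
  by apply: hd => //; rewrite gtr0_norm ?subr_gt0.
have k2 := kappa_triangle t0 (ltW ts) (ltW sq) qT.
have : chain_sum 0 s1 <= v0 t by apply: ub_le_sup; [apply: S_ub => //; exact: ltW|exists s1].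
by move: hv h12; rewrite /= -/(v0 T); lra.
Qed.

Lemma control_function : exists v : R -> R,
  [/\ {homo v : a b / a <= b},
      forall t (e : R), 0 < e -> exists2 d : R, 0 < d &
        forall s, `|s - t| < d -> `|v s - v t| <= e &
      forall a b, 0 <= a -> a < b -> b <= T -> kappa a b <= v b - v a].
Proof.
(* Composition with the projection onto [0, T] extends the variation function by constants; the
   projection is 1-Lipschitz ([cdist]), so continuity is kept. *)
pose c t := Num.max 0 (Num.min t T).
have c0 t : 0 <= c t by rewrite le_max lexx.
have cT t : c t <= T by rewrite ge_max ltW//= ge_min lexx orbT.
have cid t : 0 <= t -> t <= T -> c t = t.
  by move=> t0 tT; rewrite /c min_l// max_r.
have cmono a b : a <= b -> c a <= c b.
  move=> ab; rewrite /c; case: (leP a T); case: (leP b T);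
  case: (leP 0 a); case: (leP 0 b); case: (leP 0 T); lra.
have cdist s t : s <= t -> c t - c s <= t - s.
  rewrite /c; case: (leP s T); case: (leP t T);
  case: (leP 0 s); case: (leP 0 t); case: (leP 0 T); lra.
exists (v0 \o c); split => [a b ab|t e e0|a b a0 ab bT] /=.
- by apply: v0_mono => //; exact: cmono.
- have [d1 d10 h1] := v0_left (c0 t) (cT t) e0.
  have [d2 d20 h2] := v0_right (c0 t) (cT t) e0.
  exists (Num.min d1 d2); first by rewrite lt_min d10.
  move=> s; rewrite lt_min => /andP[]; have [st|ts] := leP s t.
    rewrite ler0_norm ?subr_le0// opprB => sd _.
    have m := v0_mono (c0 s) (cmono _ _ st) (cT t).
    rewrite ler0_norm ?subr_le0// opprB; apply: h1 => //; first exact: cmono.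
    by apply: le_lt_trans sd; exact: cdist.
  rewrite gtr0_norm ?subr_gt0// => _ sd.
  have m := v0_mono (c0 t) (cmono _ _ (ltW ts)) (cT s).
  rewrite ger0_norm ?subr_ge0//; apply: h2 => //; first exact: cmono (ltW ts).
  by apply: le_lt_trans sd; apply: cdist; exact: ltW.
- by rewrite !cid ?v0_kappa// ?(le_trans a0) ?(le_trans _ bT)// ltW.
Qed.

End ControlFunction.

(** * Piecewise constant approximations *)

Section Products.
Context {R : realType} {X : completeNormedModType R[i]}.
Variables (T w : R) (D : set X) (A : R -> X -> X) (G : R -> R -> X -> X) (v : R -> R).
Hypothesis HG : forall a, 0 <= a <= T -> qgroup w D (A a) (G a).
Hypothesis vmono : {homo v : a b / a <= b}.
Local Notation gn a := (graph_norm (A a)).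
Hypothesis HV : forall a b c y, 0 <= a <= T -> 0 <= b <= T -> 0 <= c <= T -> D y ->
  rnorm (A a y - A b y) <= `|v a - v b| * gn c y.

(** The factor 1 + |v a - v b| is relaxed to an exponential so that successive changes of norm add
    up in the exponent. *)
Lemma graph_norm_change a b y : 0 <= a <= T -> 0 <= b <= T -> D y ->
  gn a y <= expR `|v a - v b| * gn b y.
Proof.
move=> aT bT Dy; apply: (@le_trans _ _ ((1 + `|v a - v b|) * gn b y)).
  rewrite mulrDl mul1r -(subrK (gn b y) (gn a y)) addrC lerD2l.
  apply: le_trans (HV aT bT bT Dy); rewrite /graph_norm.
  by have := lerB_rnorm (A a y) (A b y); lra.
by rewrite ler_wpM2r ?graph_norm_ge0// expR_ge1Dx.
Qed.

Lemma graph_norm_group a s y : 0 <= a <= T -> D y ->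
  gn a (G a s y) <= expR (w * `|s|) * gn a y.
Proof.
move=> aT Dy; have H := HG aT; rewrite /graph_norm (gen_group H)// mulrDr.
by rewrite lerD ?(qg_bound H).
Qed.

(** Duhamel's formula without integral: f interpolates between the two groups, with derivative h G_a
    (A b - A a) G_b. Each of the two groups contributes exp(w|h|). *)
Lemma group_compare a b h y : 0 <= a <= T -> 0 <= b <= T -> D y ->
  rnorm (G a h y - G b h y) <= `|h| * expR (2 * w * `|h|) * `|v a - v b| * gn b y.
Proof.
move=> aT bT Dy; have Ha := HG aT; have Hb := HG bT; have w0 := qg_ge0 Ha.
pose M := `|v a - v b| * gn b y.
have M0 : 0 <= M by rewrite mulr_ge0 ?graph_norm_ge0.
have [h0|hn0] := eqVneq h 0.
  by rewrite h0 (qg_0 Ha) (qg_0 Hb) subrr rnorm0 normr0 !mul0r.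
have h0 : 0 < `|h| by rewrite normr_gt0.
pose E := expR (w * `|h|); have E0 : 0 < E by exact: expR_gt0.
pose f r := G a ((1 - r) * h) (G b (r * h) y).
have -> : G a h y - G b h y = f 0 - f 1.
  by rewrite /f subr0 subrr mul1r mul0r (qg_0 Ha) (qg_0 Hb).
have -> : 2 * w * `|h| = w * `|h| + w * `|h| by ring.
rewrite rnormC expRD -/E -mulrA -/M.
suff : rnorm (f 1 - f 0) <= `|h| * (E * E) * M * (1 - 0) by rewrite subr0 mulr1.
apply: mean_value_ineq => // t t0 t1 e e0.
have Dz : D (G b (t * h) y) by exact: (group_dom Hb).
set z := G b (t * h) y in Dz.
have e'0 : 0 < e / (2 * `|h| * E) by rewrite divr_gt0 ?mulr_gt0.
have [d1 d10 h1] := qg_gen Ha Dz e'0; have [d2 d20 h2] := qg_gen Hb Dz e'0.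
exists (Num.min d1 d2 / `|h|); first by rewrite divr_gt0 ?lt_min ?d10.
move=> s s0 s1; rewrite ltr_pdivlMr// -normrM lt_min => /andP[/h1 k1 /h2 k2].
set k := (s - t) * h in k1 k2.
have -> : f s - f t = G a ((1 - s) * h) (G b k z - G a k z).
  rewrite (linsub (qg_lin Ha _)) /f /z -(qg_D Ha) -(qg_D Hb) /k.
  by congr (_ - _); [congr (G a _ (G b _ y))|congr (G a _ _)]; ring.
have sh : `|(1 - s) * h| <= `|h|.
  by rewrite normrM ler_piMl// ger0_norm ?subr_ge0// gerBl.
apply: le_trans (qg_bound_le Ha _ sh) _; rewrite -/E.
have B : rnorm (G b k z - G a k z) <= `|k| * (E * M) + 2 * (e / (2 * `|h| * E) * `|k|).
  have -> : G b k z - G a k z = (- k) *:r (A a z - A b z) +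
     ((G b k z - z - k *:r A b z) - (G a k z - z - k *:r A a z)).
    by rewrite rscaleNr scalerBr; zmod.
  apply: le_trans (ler_rnormD _ _) _; apply: lerD.
    rewrite rnormZ normrN ler_wpM2l//; apply: le_trans (HV aT bT bT Dz) _.
    rewrite /M mulrCA ler_wpM2l//; apply: le_trans (graph_norm_group _ bT Dy) _.
    rewrite ler_wpM2r ?graph_norm_ge0// ler_expR ler_wpM2l// normrM.
    by rewrite ler_piMl// ger0_norm.
  by apply: le_trans (ler_rnormB _ _) _; lra.
rewrite -(ler_pM2l E0) in B; apply: le_trans B _.
rewrite le_eqVlt; apply/orP; left; apply/eqP; rewrite /k normrM; field.
by rewrite !gt_eqF.
Qed.

(** A cell after t thus contributes the identity and a cell before t its full exponential, so one
    recursion serves every position of t. *)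
Definition clamp (a b t : R) : R := Num.max a (Num.min t b).

Fixpoint prodG (N : nat) (a b t : R) (x : X) : X :=
  if N is N'.+1 then prodG N' ((a + b) / 2) b t (prodG N' a ((a + b) / 2) t x)
  else G a (clamp a b t - a) x.

Fixpoint prodGV (N : nat) (a b t : R) (x : X) : X :=
  if N is N'.+1 then prodGV N' a ((a + b) / 2) t (prodGV N' ((a + b) / 2) b t x)
  else G a (a - clamp a b t) x.

(* The propagator of the piecewise constant family that equals A at the left
   endpoint of each of the 2^N cells of [a, b]. *)
Definition stepU N a b t s x := prodG N a b t (prodGV N a b s x).

Let mid_itv a b : 0 <= a -> a <= b -> b <= T ->
  let m := (a + b) / 2 in [/\ a <= m, m <= b, 0 <= m & m <= T].
Proof. by move=> a0 ab bT m; rewrite /m; split; lra. Qed.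

Let inT a b : 0 <= a -> a <= b -> b <= T -> 0 <= a <= T.
Proof. by move=> -> ab bT; rewrite (le_trans ab). Qed.

Lemma prodG_ge N a b t x : a <= b -> b <= t -> prodG N a b t x = prodG N a b b x.
Proof.
elim: N a b t x => [|N IH] a b t x ab bt /=.
  by rewrite /clamp minxx min_r.
have [am mb] : a <= (a + b) / 2 /\ (a + b) / 2 <= b by lra.
by rewrite (IH _ b t)// (IH a _ t)// ?(le_trans mb)// [in RHS](IH a).
Qed.

Lemma prodGV_ge N a b t x : a <= b -> b <= t -> prodGV N a b t x = prodGV N a b b x.
Proof.
elim: N a b t x => [|N IH] a b t x ab bt /=.
  by rewrite /clamp minxx min_r.
have [am mb] : a <= (a + b) / 2 /\ (a + b) / 2 <= b by lra.
by rewrite (IH _ b t)// (IH a _ t)// ?(le_trans mb)// [in RHS](IH a).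
Qed.

Lemma prodG_le N a b t x : 0 <= a -> a <= b -> b <= T -> t <= a -> prodG N a b t x = x.
Proof.
elim: N a b x => [|N IH] a b x a0 ab bT ta /=.
  rewrite /clamp min_l ?(le_trans ta)// max_l// subrr.
  exact: (qg_0 (HG (inT a0 ab bT))).
have [am mb m0 mT] := mid_itv a0 ab bT.
by rewrite !IH// (le_trans ta).
Qed.

Lemma prodGV_le N a b t x : 0 <= a -> a <= b -> b <= T -> t <= a -> prodGV N a b t x = x.
Proof.
elim: N a b x => [|N IH] a b x a0 ab bT ta /=.
  rewrite /clamp min_l ?(le_trans ta)// max_l// subrr.
  exact: (qg_0 (HG (inT a0 ab bT))).
have [am mb m0 mT] := mid_itv a0 ab bT.
by rewrite !IH// (le_trans ta).
Qed.

Lemma prodGK N a b t x : 0 <= a -> a <= b -> b <= T -> prodGV N a b t (prodG N a b t x) = x.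
Proof.
elim: N a b x => [|N IH] a b x a0 ab bT /=.
  by rewrite -(opprB _ a) (qg_NK (HG (inT a0 ab bT))).
have [am mb m0 mT] := mid_itv a0 ab bT.
by rewrite !IH.
Qed.

Lemma prodGVK N a b t x : 0 <= a -> a <= b -> b <= T -> prodG N a b t (prodGV N a b t x) = x.
Proof.
elim: N a b x => [|N IH] a b x a0 ab bT /=.
  by rewrite -(opprB _ a) (qg_KN (HG (inT a0 ab bT))).
have [am mb m0 mT] := mid_itv a0 ab bT.
by rewrite !IH.
Qed.

Lemma prodG_lin N a b t : 0 <= a -> a <= b -> b <= T -> lin (prodG N a b t).
Proof.
elim: N a b => [|N IH] a b a0 ab bT c x y /=.
  exact: (qg_lin (HG (inT a0 ab bT))).
by have [am mb m0 mT] := mid_itv a0 ab bT; rewrite !IH.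
Qed.

Lemma prodGV_lin N a b t : 0 <= a -> a <= b -> b <= T -> lin (prodGV N a b t).
Proof.
elim: N a b => [|N IH] a b a0 ab bT c x y /=.
  exact: (qg_lin (HG (inT a0 ab bT))).
by have [am mb m0 mT] := mid_itv a0 ab bT; rewrite !IH.
Qed.

Lemma prodG_dom N a b t y : 0 <= a -> a <= b -> b <= T -> D y -> D (prodG N a b t y).
Proof.
elim: N a b y => [|N IH] a b y a0 ab bT Dy /=.
  exact: (group_dom (HG (inT a0 ab bT))).
by have [am mb m0 mT] := mid_itv a0 ab bT; apply: (IH) => //; exact: IH.
Qed.

Lemma prodGV_dom N a b t y : 0 <= a -> a <= b -> b <= T -> D y -> D (prodGV N a b t y).
Proof.
elim: N a b y => [|N IH] a b y a0 ab bT Dy /=.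
  exact: (group_dom (HG (inT a0 ab bT))).
by have [am mb m0 mT] := mid_itv a0 ab bT; apply: (IH) => //; exact: IH.
Qed.

Lemma stepU_lin N a b t s : 0 <= a -> a <= b -> b <= T -> lin (stepU N a b t s).
Proof. by move=> a0 ab bT c x y; rewrite /stepU prodGV_lin// prodG_lin. Qed.

Lemma stepU_dom N a b t s y : 0 <= a -> a <= b -> b <= T -> D y -> D (stepU N a b t s y).
Proof. by move=> a0 ab bT Dy; apply: prodG_dom => //; exact: prodGV_dom. Qed.

Lemma stepU_comp N a b t r s x : 0 <= a -> a <= b -> b <= T ->
  stepU N a b t r (stepU N a b r s x) = stepU N a b t s x.
Proof. by move=> a0 ab bT; rewrite /stepU prodGK. Qed.

Lemma stepU0 a b t s x : 0 <= a -> b <= T -> a <= s <= b -> a <= t <= b ->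
  stepU 0 a b t s x = G a (t - s) x.
Proof.
move=> a0 bT /andP[as_ sb] /andP[at_ tb]; rewrite /stepU /= /clamp !min_l// !max_r//.
by rewrite -(qg_D (HG (inT a0 (le_trans as_ sb) bT))) subrKA.
Qed.

(** By definition [stepU] runs from s back to a and forward to t. The common factors cancel, leaving
    the direct path from s to t, and bounds in |t - s| can be proved by induction on the halves. *)
Lemma stepU_split a b t s : 0 <= a -> b <= T -> a <= s <= b -> a <= t <= b ->
  let m := (a + b) / 2 in
  [\/ [/\ t <= m, s <= m & forall N x, stepU N.+1 a b t s x = stepU N a m t s x],
      [/\ m <= t, m <= s & forall N x, stepU N.+1 a b t s x = stepU N m b t s x],
      [/\ m <= t, s <= m & forall N x,
         stepU N.+1 a b t s x = stepU N m b t m (stepU N a m m s x)] |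
      [/\ t <= m, m <= s & forall N x,
         stepU N.+1 a b t s x = stepU N a m t m (stepU N m b m s x)]].
Proof.
move=> a0 bT /andP[as_ sb] /andP[at_ tb] m.
have [am mb m0 mT] := mid_itv a0 (le_trans as_ sb) bT; rewrite -/m in am mb m0 mT.
have [tm|/ltW mt] := leP t m; have [sm|/ltW ms] := leP s m.
- apply: Or41; split => // N x; rewrite /stepU /= -/m.
  by rewrite (prodGV_le _ _ m0)// (prodG_le _ _ m0).
- apply: Or44; split => // N x; rewrite /stepU /= -/m.
  by rewrite (prodG_le _ _ m0)// (prodGV_ge _ _ am ms) (prodG_le _ (prodGV N m b s x) m0).
- apply: Or43; split => // N x; rewrite /stepU /= -/m.
  by rewrite (prodG_ge _ _ am mt) (prodGV_le _ x m0)// (prodGV_le _ _ m0).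
- apply: Or42; split => // N x; rewrite /stepU /= -/m.
  by rewrite (prodG_ge _ _ am mt) (prodGV_ge _ _ am ms) prodGVK.
Qed.


Let dist_split (t r s : R) : s <= r <= t \/ t <= r <= s -> `|t - s| = `|t - r| + `|r - s|.
Proof.
case=> /andP[h1 h2].
  by rewrite !ger0_norm ?subr_ge0// ?(le_trans h1)//; ring.
by rewrite !ler0_norm ?subr_le0// ?(le_trans h1)//; ring.
Qed.

Lemma stepU_bound N a b t s x : 0 <= a -> b <= T -> a <= s <= b -> a <= t <= b ->
  rnorm (stepU N a b t s x) <= expR (w * `|t - s|) * rnorm x.
Proof.
elim: N a b t s x => [|N IH] a b t s x a0 bT hs ht.
  rewrite stepU0//; case/andP: hs => as_ sb.
  exact: (qg_bound (HG (inT a0 (le_trans as_ sb) bT))).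
have [hs1 hs2] := andP hs; have [ht1 ht2] := andP ht.
have [am mb m0 mT] := mid_itv a0 (le_trans hs1 hs2) bT.
case: (stepU_split a0 bT hs ht); set m := (a + b) / 2 => -[tm sm ->].
- by apply: IH => //; apply/andP.
- by apply: IH => //; apply/andP.
- rewrite (@dist_split t m s); last by left; rewrite sm.
  rewrite mulrDr expRD -mulrA; apply: le_trans (IH _ _ _ _ _ _ _ _ _) _ => //.
  + by rewrite lexx.
  + by rewrite tm.
  + by rewrite ler_wpM2l ?expR_ge0// IH//; apply/andP.
- rewrite (@dist_split t m s); last by right; rewrite tm.
  rewrite mulrDr expRD -mulrA; apply: le_trans (IH _ _ _ _ _ _ _ _ _) _ => //.
  + by rewrite am lexx.
  + by rewrite ht1.
  + by rewrite ler_wpM2l ?expR_ge0// IH//; [rewrite sm|rewrite lexx].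
Qed.

(** Twice the variation of [v] on the stretch of length H before r, cut off at a. The generator in
    use at time r is frozen up to one cell earlier, and the graph norm has to be changed to that
    time and back. *)
Definition cell_excess (a H r : R) : R := 2 * (v r - v (Num.max a (r - H))).

Let cell_size (a b : R) N : ((a + b) / 2 - a) * dy N = (b - a) * dy N.+1.
Proof. by rewrite /dy exprS; field. Qed.

Let cell_size' (a b : R) N : (b - (a + b) / 2) * dy N = (b - a) * dy N.+1.
Proof. by rewrite /dy exprS; field. Qed.

Let dy_pos N : 0 < dy N :> R. Proof. exact: dy_gt0. Qed.

Lemma stepU_graph_norm N a b t s y : 0 <= a -> b <= T -> a <= s <= b -> a <= t <= b ->
  D y ->
  gn t (stepU N a b t s y) <=
  expR (w * `|t - s| + `|v t - v s| +
        cell_excess a ((b - a) * dy N) (Num.min t s)) * gn s y.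
Proof.
elim: N a b t s y => [|N IH] a b t s y a0 bT hs ht Dy;
    have [hs1 hs2] := andP hs; have [ht1 ht2] := andP ht;
    have ab : a <= b by exact: le_trans hs2.
  have aT := inT a0 ab bT.
  have sT : 0 <= s <= T by rewrite (le_trans a0)// (le_trans hs2).
  have tT : 0 <= t <= T by rewrite (le_trans a0)// (le_trans ht2).
  rewrite stepU0//.
  have D1 : D (G a (t - s) y) by exact: (group_dom (HG aT)).
  apply: le_trans (graph_norm_change tT aT D1) _.
  apply: (@le_trans _ _ (expR `|v t - v a| * (expR (w * `|t - s|) *
      (expR `|v a - v s| * gn s y)))).
    rewrite ler_wpM2l ?expR_ge0//; apply: le_trans (graph_norm_group _ aT Dy) _.
    by rewrite ler_wpM2l ?expR_ge0//; exact: graph_norm_change.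
  rewrite !mulrA -!expRD ler_wpM2r ?graph_norm_ge0// ler_expR.
  have m1 : Num.max a (Num.min t s - (b - a) * dy 0) = a.
    rewrite max_l// /dy expr0 mulr1 lerBlDr addrCA subrr addr0.
    by rewrite ge_min ht2.
  have e1 : `|v t - v a| = v t - v a by rewrite ger0_norm// subr_ge0 vmono.
  have e2 : `|v a - v s| = v s - v a by rewrite ler0_norm ?subr_le0 ?vmono// opprB.
  rewrite /cell_excess m1 e1 e2; case: (leP t s) => [ts|/ltW ts]; have vts := vmono ts.
    by rewrite [`|v t - v s|]ler0_norm ?subr_le0//; lra.
  by rewrite [`|v t - v s|]ger0_norm ?subr_ge0//; lra.
have [am mb m0 mT] := mid_itv a0 (le_trans hs1 hs2) bT.
have H0 : 0 <= (b - a) * dy N.+1 by rewrite mulr_ge0 ?subr_ge0// ltW.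
(* The midpoint is a partition point, so the part of a path that lies in the right half and ends at
   the midpoint has no excess. *)
have exc0 r H : 0 <= H -> cell_excess r H r = 0.
  by move=> h; rewrite /cell_excess max_l ?subrr ?mulr0// gerBl.
have excm r r' H q : r <= r' -> cell_excess r' H q <= cell_excess r H q.
  move=> rr; rewrite /cell_excess ler_wpM2l// lerD2l lerN2 vmono//.
  by rewrite ge_max !le_max rr lexx orbT.
case: (stepU_split a0 bT hs ht); set m := (a + b) / 2 => -[tm sm ->].
- rewrite -cell_size; apply: IH => //; first by rewrite hs1.
  by rewrite ht1.
- apply: le_trans (IH _ _ _ _ _ _ _ _ _ _) _ => //; [by rewrite sm|by rewrite tm|].
  rewrite cell_size' ler_wpM2r ?graph_norm_ge0// ler_expR lerD2l.
  exact: excm.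
- apply: le_trans (IH _ _ _ _ _ _ _ _ _ _) _ => //.
  + by rewrite lexx.
  + by rewrite tm.
  + exact: stepU_dom.
  rewrite min_r// (min_r (le_trans sm tm)) exc0; last by rewrite cell_size'.
  have := IH a m m s y a0 mT; rewrite hs1 sm am lexx => /(_ isT isT Dy) h.
  apply: le_trans (ler_wpM2l (expR_ge0 _) h) _.
  rewrite mulrA -expRD ler_wpM2r ?graph_norm_ge0// ler_expR min_r// cell_size.
  rewrite (@dist_split t m s); last by left; rewrite sm.
  rewrite (@dist_split (v t) (v m) (v s)); last by left; rewrite !vmono.
  lra.
- apply: le_trans (IH _ _ _ _ _ _ _ _ _ _) _ => //.
  + by rewrite am lexx.
  + by rewrite ht1.
  + exact: stepU_dom.
  rewrite min_l// (min_l (le_trans tm sm)).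
  have := IH m b m s y m0 bT; rewrite sm hs2 lexx mb => /(_ isT isT Dy) h.
  apply: le_trans (ler_wpM2l (expR_ge0 _) h) _.
  rewrite mulrA -expRD ler_wpM2r ?graph_norm_ge0// ler_expR min_l// exc0; last by rewrite cell_size'.
  rewrite cell_size.
  rewrite (@dist_split t m s); last by right; rewrite tm.
  rewrite (@dist_split (v t) (v m) (v s)); last by right; rewrite !vmono.
  lra.
Qed.

(** Joins two consecutive steps: the error of the inner one is transported by the outer, and the
    error of the outer acts on a datum grown by the inner. The rate 2w absorbs both growth
    factors. *)
Let expR_add_le (c1 c2 h1 h2 : R) : 0 <= w -> 0 <= h1 -> 0 <= h2 -> 0 <= c1 -> 0 <= c2 ->
  expR (w * h2) * (c1 * expR (2 * w * h1)) + c2 * expR (2 * w * h2) * expR (w * h1) <=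
  (c1 + c2) * expR (2 * w * (h1 + h2)).
Proof.
move=> w0 h10 h20 c10 c20; rewrite [leRHS]mulrDl; apply: lerD.
  rewrite mulrCA -expRD ler_wpM2l// ler_expR; nra.
rewrite -mulrA -expRD ler_wpM2l// ler_expR; nra.
Qed.

(** The 3 is one variation from |v t - v s| and two from the excess; this is enough where only
    boundedness matters. *)
Lemma stepU_graph_norm_coarse N a b t s y : 0 <= a -> b <= T ->
  a <= s <= b -> a <= t <= b -> D y ->
  gn t (stepU N a b t s y) <= expR (w * `|t - s| + 3 * (v b - v a)) * gn s y.
Proof.
move=> a0 bT hs ht Dy; have [hs1 hs2] := andP hs; have [ht1 ht2] := andP ht.
apply: le_trans (stepU_graph_norm N a0 bT hs ht Dy) _.
rewrite ler_wpM2r ?graph_norm_ge0// ler_expR -addrA lerD2l.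
have e1 : cell_excess a ((b - a) * dy N) (Num.min t s) <= 2 * (v b - v a).
  rewrite /cell_excess ler_wpM2l// lerB ?vmono//; first by rewrite ge_min ht2.
  by rewrite le_max lexx.
have e2 : `|v t - v s| <= v b - v a.
  have := vmono hs1; have := vmono hs2; have := vmono ht1; have := vmono ht2.
  by rewrite ler_norml; lra.
lra.
Qed.

(** The induction on halves closes because both have the same mesh H and their variations add; 4V
    leaves room for the 3V of the coarse bound. *)
Let refine_add (H V1 V2 h1 h2 : R) : 0 <= w -> 0 <= h1 -> 0 <= h2 -> 0 <= V1 -> 0 <= V2 ->
  0 <= H ->
  expR (w * h2) * (H * V1 * expR (2 * w * h1 + 4 * V1)) +
    H * V2 * expR (2 * w * h2 + 4 * V2) * expR (w * h1 + 3 * V1) <=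
  H * (V1 + V2) * expR (2 * w * (h1 + h2) + 4 * (V1 + V2)).
Proof.
move=> w0 h10 h20 V10 V20 H0; rewrite mulrDr [leRHS]mulrDl; apply: lerD.
  rewrite mulrCA -expRD ler_wpM2l ?mulr_ge0// ler_expR; nra.
rewrite -mulrA -expRD ler_wpM2l ?mulr_ge0// ler_expR; nra.
Qed.

(* Refining the partition once costs (mesh) * (variation), which is summable
   over the levels N. *)
Lemma stepU_refine N a b t s y : 0 <= a -> b <= T -> a <= s <= b -> a <= t <= b -> D y ->
  rnorm (stepU N.+1 a b t s y - stepU N a b t s y) <=
  (b - a) * dy N * (v b - v a) * expR (2 * w * `|t - s| + 4 * (v b - v a)) * gn s y.
Proof.
elim: N a b t s y => [|N IH] a b t s y a0 bT hs ht Dy;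
    have [hs1 hs2] := andP hs; have [ht1 ht2] := andP ht;
    have ab : a <= b by exact: le_trans hs2.
  have aT := inT a0 ab bT; have Ha := HG aT; have w0 := qg_ge0 Ha.
  have sT : 0 <= s <= T by rewrite (le_trans a0)// (le_trans hs2).
  have [am mb m0 mT] := mid_itv a0 ab bT.
  set m := (a + b) / 2 in am mb m0 mT.
  have mT' := inT m0 mb bT.
  rewrite (stepU0 _ a0 bT hs ht).
  have V0 : 0 <= v b - v a by rewrite subr_ge0 vmono.
  have Vm : `|v m - v a| <= v b - v a by rewrite ger0_norm ?subr_ge0 ?vmono// lerD2r vmono.
  have Vs : `|v a - v s| <= v b - v a.
    by rewrite ler0_norm ?subr_le0 ?vmono// opprB lerD2r vmono.
  (* One halving replaces [A a] by [A m] on the right half only, so only the part of the path beyond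
     m contributes. *)
  have K : rnorm (stepU 1 a b t s y - G a (t - s) y) <=
      `|t - s| * expR (2 * w * `|t - s|) * (`|v m - v a| * gn a y).
    have gD h1 h2 : G a (h1 + h2) y = G a h1 (G a h2 y) by exact: (qg_D Ha).
    case: (stepU_split a0 bT hs ht); rewrite -/m => -[tm sm ->].
    - rewrite stepU0// ?hs1 ?ht1// subrr rnorm0.
      by rewrite !mulr_ge0 ?expR_ge0// graph_norm_ge0.
    - rewrite stepU0// ?sm ?tm// mulrA; exact: group_compare.
    - rewrite stepU0// ?tm ?lexx// stepU0// ?hs1 ?am ?lexx//.
      have Dz : D (G a (m - s) y) by exact: (group_dom Ha).
      have -> : G a (t - s) y = G a (t - m) (G a (m - s) y) by rewrite -gD subrKA.
      apply: le_trans (group_compare (t - m) mT' aT Dz) _.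
      apply: (@le_trans _ _ (`|t - m| * expR (2 * w * `|t - m|) * expR (w * `|m - s|) *
         (`|v m - v a| * gn a y))).
        rewrite -!mulrA ler_wpM2l// ler_wpM2l ?expR_ge0// mulrCA ler_wpM2l//.
        exact: graph_norm_group.
      apply: ler_wpM2r; first by rewrite mulr_ge0 ?graph_norm_ge0.
      rewrite (@dist_split t m s); last by left; rewrite sm.
      have := @expR_add_le 0 `|t - m| `|m - s| `|t - m|.
      rewrite mul0r mulr0 !add0r => /(_ w0 (normr_ge0 _) (normr_ge0 _) (lexx _) (normr_ge0 _)).
      move=> /le_trans; apply; rewrite (addrC `|m - s|) ler_wpM2r ?expR_ge0// lerDl.
      exact: normr_ge0.
    - rewrite stepU0// ?lexx ?am ?ht1// stepU0// ?sm ?lexx//.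
      have -> : G a (t - s) y = G a (t - m) (G a (m - s) y) by rewrite -gD subrKA.
      rewrite -(linsub (qg_lin Ha _)); apply: le_trans (qg_bound Ha _ _) _.
      apply: (@le_trans _ _ (expR (w * `|t - m|) * (`|m - s| * expR (2 * w * `|m - s|)) *
         (`|v m - v a| * gn a y))).
        rewrite -[leRHS]mulrA ler_wpM2l ?expR_ge0// mulrA; exact: group_compare.
      apply: ler_wpM2r; first by rewrite mulr_ge0 ?graph_norm_ge0.
      rewrite (@dist_split t m s); last by right; rewrite tm.
      have := @expR_add_le `|m - s| 0 `|m - s| `|t - m|.
      rewrite !mul0r !addr0 => /(_ w0 (normr_ge0 _) (normr_ge0 _) (normr_ge0 _) (lexx _)).
      move=> /le_trans; apply; rewrite (addrC `|m - s|) ler_wpM2r ?expR_ge0// lerDr.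
      exact: normr_ge0.
  apply: le_trans K _.
  have ts : `|t - s| <= b - a by rewrite ler_norml; lra.
  rewrite /dy expr0 mulr1 expRD.
  have g1 : gn a y <= expR (4 * (v b - v a)) * gn s y.
    apply: le_trans (graph_norm_change aT sT Dy) _.
    by rewrite ler_wpM2r ?graph_norm_ge0// ler_expR; lra.
  have -> : (b - a) * (v b - v a) * (expR (2 * w * `|t - s|) * expR (4 * (v b - v a))) * gn s y =
    (b - a) * expR (2 * w * `|t - s|) * ((v b - v a) * (expR (4 * (v b - v a)) * gn s y)) by ring.
  apply: ler_pM; rewrite ?mulr_ge0 ?expR_ge0 ?graph_norm_ge0//.
    by rewrite ler_wpM2r ?expR_ge0.
  by apply: ler_pM; rewrite ?graph_norm_ge0.
have w0 := qg_ge0 (HG (inT a0 ab bT)).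
have [am mb m0 mT] := mid_itv a0 ab bT.
case: (stepU_split a0 bT hs ht); set m := (a + b) / 2 in am mb m0 mT * => -[tm sm E];
  rewrite !{}E.
- have h1 : a <= s <= m by rewrite hs1.
  have h2 : a <= t <= m by rewrite ht1.
  apply: le_trans (IH a m t s y a0 mT h1 h2 Dy) _.
  rewrite cell_size ler_wpM2r ?graph_norm_ge0//.
  have V := vmono mb; have V' := vmono am.
  rewrite -!mulrA; apply: ler_wpM2l; first by rewrite subr_ge0.
  apply: ler_wpM2l; first exact: ltW.
  by apply: ler_pM; rewrite ?subr_ge0 ?expR_ge0// ?ler_expR; lra.
- have h1 : m <= s <= b by rewrite sm.
  have h2 : m <= t <= b by rewrite tm.
  apply: le_trans (IH m b t s y m0 bT h1 h2 Dy) _.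
  rewrite cell_size' ler_wpM2r ?graph_norm_ge0//.
  have V := vmono mb; have V' := vmono am.
  rewrite -!mulrA; apply: ler_wpM2l; first by rewrite subr_ge0.
  apply: ler_wpM2l; first exact: ltW.
  by apply: ler_pM; rewrite ?subr_ge0 ?expR_ge0// ?ler_expR; lra.
- have h1 : a <= s <= m by rewrite hs1.
  have h1' : a <= m <= m by rewrite am lexx.
  have h2 : m <= t <= b by rewrite tm.
  have h2' : m <= m <= b by rewrite lexx.
  have D1 : D (stepU N a m m s y) by exact: stepU_dom.
  set U1 := stepU N a m m s y in D1 *.
  (* With U' the refined product, U'U' - UU = U'(U' - U) + (U' - U)U: the outer U' needs its bound
     in X, the inner U its bound in the graph norm. *)
  rewrite -(subrK (stepU N.+1 m b t m U1) (stepU N.+1 m b t m (stepU N.+1 a m m s y))) -addrA.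
  rewrite -(linsub (stepU_lin N.+1 t m m0 mb bT)).
  apply: le_trans (ler_rnormD _ _) _.
  have k1 := IH a m m s y a0 mT h1 h1' Dy.
  have k2 := IH m b t m U1 m0 bT h2' h2 D1.
  have k3 := stepU_graph_norm_coarse N a0 mT h1 h1' Dy.
  rewrite cell_size in k1; rewrite cell_size' in k2.
  have H0 : 0 <= (b - a) * dy N.+1 by rewrite mulr_ge0 ?subr_ge0// ltW.
  have V1 : 0 <= v m - v a by rewrite subr_ge0 vmono.
  have V2 : 0 <= v b - v m by rewrite subr_ge0 vmono.
  rewrite (@dist_split t m s); last by left; rewrite sm.
  apply: le_trans (lerD (stepU_bound _ _ m0 bT h2' h2) k2) _.
  apply: le_trans (lerD (ler_wpM2l (expR_ge0 _) k1) (ler_wpM2l _ k3)) _.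
    by rewrite mulr_ge0 ?expR_ge0// mulr_ge0.
  rewrite (mulrA (expR (w * `|t - m|))) (mulrA _ (expR (w * `|m - s| + _))) -mulrDl.
  apply: ler_wpM2r; first exact: graph_norm_ge0.
  have := refine_add w0 (normr_ge0 (m - s)) (normr_ge0 (t - m)) V1 V2 H0.
  by rewrite (addrC `|m - s|) (_ : v m - v a + _ = v b - v a)//; ring.
- have h1 : m <= s <= b by rewrite sm.
  have h1' : m <= m <= b by rewrite lexx.
  have h2 : a <= t <= m by rewrite ht1.
  have h2' : a <= m <= m by rewrite am lexx.
  have D1 : D (stepU N m b m s y) by exact: stepU_dom.
  set U1 := stepU N m b m s y in D1 *.
  rewrite -(subrK (stepU N.+1 a m t m U1) (stepU N.+1 a m t m (stepU N.+1 m b m s y))) -addrA.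
  rewrite -(linsub (stepU_lin N.+1 t m a0 am mT)).
  apply: le_trans (ler_rnormD _ _) _.
  have k1 := IH m b m s y m0 bT h1 h1' Dy.
  have k2 := IH a m t m U1 a0 mT h2' h2 D1.
  have k3 := stepU_graph_norm_coarse N m0 bT h1 h1' Dy.
  rewrite cell_size' in k1; rewrite cell_size in k2.
  have H0 : 0 <= (b - a) * dy N.+1 by rewrite mulr_ge0 ?subr_ge0// ltW.
  have V1 : 0 <= v m - v a by rewrite subr_ge0 vmono.
  have V2 : 0 <= v b - v m by rewrite subr_ge0 vmono.
  rewrite (@dist_split t m s); last by right; rewrite tm.
  apply: le_trans (lerD (stepU_bound _ _ a0 mT h2' h2) k2) _.
  apply: le_trans (lerD (ler_wpM2l (expR_ge0 _) k1) (ler_wpM2l _ k3)) _.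
    by rewrite mulr_ge0 ?expR_ge0// mulr_ge0.
  rewrite (mulrA (expR (w * `|t - m|))) (mulrA _ (expR (w * `|m - s| + _))) -mulrDl.
  apply: ler_wpM2r; first exact: graph_norm_ge0.
  have := refine_add w0 (normr_ge0 (m - s)) (normr_ge0 (t - m)) V2 V1 H0.
  by rewrite (addrC `|m - s|) (_ : v b - v m + _ = v b - v a)//; ring.
Qed.

(* The generators used by stepU N between s and t are those at times at most
   one cell to the left of the interval between s and t. *)
Lemma stepU_frozen N a b t s c (sigma : R) y : 0 <= a -> b <= T ->
  a <= s <= b -> a <= t <= b -> 0 <= c <= T -> D y -> 0 <= sigma ->
  (forall r, 0 <= r <= T -> Num.min t s - (b - a) * dy N <= r -> r <= Num.max t s ->
     `|v r - v c| <= sigma) ->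
  rnorm (stepU N a b t s y - G c (t - s) y) <=
  `|t - s| * expR (2 * w * `|t - s|) * (sigma * gn c y).
Proof.
move=> + + + + cT + sg0; have Hc := HG cT; have w0 := qg_ge0 Hc.
have gD h1 h2 z : G c (h1 + h2) z = G c h1 (G c h2 z) by exact: (qg_D Hc).
elim: N a b t s y => [|N IH] a b t s y a0 bT hs ht Dy hv;
    have [hs1 hs2] := andP hs; have [ht1 ht2] := andP ht;
    have ab : a <= b by exact: le_trans hs2.
  have aT := inT a0 ab bT.
  rewrite (stepU0 _ a0 bT hs ht); apply: le_trans (group_compare _ aT cT Dy) _.
  rewrite -!mulrA ler_wpM2l// ler_wpM2l ?expR_ge0// ler_wpM2r ?graph_norm_ge0//.
  apply: hv => //; last by rewrite le_max ht1.
  by rewrite /dy expr0 mulr1 lerBlDr addrC subrK ge_min ht2.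
have [am mb m0 mT] := mid_itv a0 ab bT.
case: (stepU_split a0 bT hs ht); set m := (a + b) / 2 in am mb m0 mT * => -[tm sm ->].
- by apply: IH => //; rewrite ?hs1 ?ht1// cell_size.
- by apply: IH => //; rewrite ?sm ?tm// cell_size'.
- have h1 : a <= s <= m by rewrite hs1.
  have h1' : a <= m <= m by rewrite am lexx.
  have h2 : m <= t <= b by rewrite tm.
  have h2' : m <= m <= b by rewrite lexx.
  have k1 : rnorm (stepU N a m m s y - G c (m - s) y) <=
      `|m - s| * expR (2 * w * `|m - s|) * (sigma * gn c y).
    apply: IH => // r rT; rewrite min_r// max_l// cell_size => r1 r2.
    by apply: hv => //; rewrite ?(min_r (le_trans sm tm))// le_max (le_trans r2).
  have Dz : D (G c (m - s) y) by exact: (group_dom Hc).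
  have k2 : rnorm (stepU N m b t m (G c (m - s) y) - G c (t - m) (G c (m - s) y)) <=
      `|t - m| * expR (2 * w * `|t - m|) * (sigma * gn c (G c (m - s) y)).
    apply: IH => // r rT; rewrite min_r// max_l// cell_size' => r1 r2.
    apply: hv => //; last by rewrite le_max r2.
    by rewrite (min_r (le_trans sm tm)) (le_trans _ r1)// lerD2r.
  rewrite -(subrKA m) gD.
  (* The inner factor of the second difference is the exact group of [A c], whose graph norm n_c
     grows only at rate w. *)
  rewrite -(subrK (stepU N m b t m (G c (m - s) y)) (stepU N m b t m (stepU N a m m s y))) -addrA.
  rewrite -(linsub (stepU_lin N t m m0 mb bT)).
  apply: le_trans (ler_rnormD _ _) _.
  apply: le_trans (lerD (stepU_bound _ _ m0 bT h2' h2) k2) _.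
  apply: le_trans (lerD (ler_wpM2l (expR_ge0 _) k1) (ler_wpM2l _ (ler_wpM2l sg0 (graph_norm_group _ cT Dy)))) _.
    by rewrite mulr_ge0 ?expR_ge0.
  rewrite subrKA (@dist_split t m s); last by left; rewrite sm.
  rewrite (mulrA (expR _)) (mulrCA sigma) (mulrA _ (expR _) (sigma * _)) -mulrDl.
  apply: ler_wpM2r; first by rewrite mulr_ge0 ?graph_norm_ge0.
  rewrite (addrC `|t - m|).
  exact: (expR_add_le w0).
- have h1 : m <= s <= b by rewrite sm.
  have h1' : m <= m <= b by rewrite lexx.
  have h2 : a <= t <= m by rewrite ht1.
  have h2' : a <= m <= m by rewrite am lexx.
  have k1 : rnorm (stepU N m b m s y - G c (m - s) y) <=
      `|m - s| * expR (2 * w * `|m - s|) * (sigma * gn c y).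
    apply: IH => // r rT; rewrite min_l// max_r// cell_size' => r1 r2.
    apply: hv => //; last by rewrite le_max r2 orbT.
    by rewrite (min_l (le_trans tm sm)) (le_trans _ r1)// lerD2r.
  have Dz : D (G c (m - s) y) by exact: (group_dom Hc).
  have k2 : rnorm (stepU N a m t m (G c (m - s) y) - G c (t - m) (G c (m - s) y)) <=
      `|t - m| * expR (2 * w * `|t - m|) * (sigma * gn c (G c (m - s) y)).
    apply: IH => // r rT; rewrite min_l// max_r// cell_size => r1 r2.
    apply: hv => //; first by rewrite (min_l (le_trans tm sm)).
    by rewrite le_max (le_trans r2 sm) orbT.
  rewrite -(subrKA m) gD.
  rewrite -(subrK (stepU N a m t m (G c (m - s) y)) (stepU N a m t m (stepU N m b m s y))) -addrA.
  rewrite -(linsub (stepU_lin N t m a0 am mT)).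
  apply: le_trans (ler_rnormD _ _) _.
  apply: le_trans (lerD (stepU_bound _ _ a0 mT h2' h2) k2) _.
  apply: le_trans (lerD (ler_wpM2l (expR_ge0 _) k1) (ler_wpM2l _ (ler_wpM2l sg0 (graph_norm_group _ cT Dy)))) _.
    by rewrite mulr_ge0 ?expR_ge0.
  rewrite subrKA (@dist_split t m s); last by right; rewrite tm.
  rewrite (mulrA (expR _)) (mulrCA sigma) (mulrA _ (expR _) (sigma * _)) -mulrDl.
  apply: ler_wpM2r; first by rewrite mulr_ge0 ?graph_norm_ge0.
  rewrite (addrC `|t - m|).
  exact: (expR_add_le w0).
Qed.

End Products.

(** * Limits and uniqueness *)

Section RealLemmas.
Context {R : realType}.

Lemma expR_small (g e : R) : 0 < e ->
  exists2 d : R, 0 < d & forall h, h <= d -> expR h * `|g| <= `|g| + e.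
Proof.
move=> e0.
have : \forall h \near (0 : R), expR h * `|g| < `|g| + e.
  have : expR h * `|g| @[h --> (0:R)] --> expR 0 * `|g|.
    by apply: cvgMl; exact: continuous_expR.
  by move/cvgr_lt; apply; rewrite expR0 mul1r ltrDl.
move=> /nbhs_ballP[r /= r0 hr]; exists (r / 2); first by rewrite divr_gt0.
move=> h hd; apply: (@le_trans _ _ (expR (r / 2) * `|g|)).
  by rewrite ler_wpM2r// ler_expR.
apply/ltW/hr; rewrite /ball/= sub0r normrN gtr0_norm ?divr_gt0//.
by rewrite ltr_pdivrMr// ltr_pMr// ltr1n.
Qed.

End RealLemmas.

Section Limits.
Context {R : realType} {X : completeNormedModType R[i]}.

Lemma geometric_cvg (u : nat -> X) (K : R) : 0 <= K ->
  (forall n, rnorm (u n.+1 - u n) <= K * dy n) -> exists l, tends u l.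
Proof.
move=> K0 hu; apply: rcauchy_cvg => e e0.
(* K 2^-n = 2K(2^-n - 2^-(n+1)), so the increments telescope. *)
have h n k : rnorm (u (n + k)%N - u n) <= 2 * K * (dy n - dy (n + k)).
  elim: k => [|k IH]; first by rewrite addn0 !subrr rnorm0 mulr0.
  rewrite addnS; apply: le_trans (ler_rdistD (u (n + k)%N) _ _) _.
  have := hu (n + k)%N; have := @dyS R (n + k)%N; nra.
have q0 : 0 < e / (2 * K + 1) by rewrite divr_gt0// ltr_wpDl// mulr_ge0.
have [N hN] := dy_small q0.
exists N => m n Nm mn; rewrite -(subnKC mn); apply: le_trans (h _ _) _.
have dm : dy m <= dy N :> R by exact: dy_le.
have := @dy_gt0 R (m + (n - m))%N; have := @dy_gt0 R m.
move: hN; rewrite ler_pdivlMr ?ltr_wpDl ?mulr_ge0//; nra.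
Qed.

Lemma tends_extend (D : set X) (B : nat -> X -> X) (C : R) :
  (forall n, lin (B n)) -> (forall n x, rnorm (B n x) <= C * rnorm x) ->
  (forall x (e : R), 0 < e -> exists2 y, D y & rnorm (y - x) <= e) ->
  (forall y, D y -> exists l, tends (B ^~ y) l) ->
  forall x, exists l, tends (B ^~ x) l.
Proof.
move=> linB hC dense hB x; apply: rcauchy_cvg => e e0.
have C0 : 0 < `|C| + 1 by rewrite ltr_wpDl.
have e1 : 0 < e / 4 / (`|C| + 1) by rewrite !divr_gt0.
have [y Dy hy] := dense x _ e1; have [l hl] := hB y Dy.
have e2 : 0 < e / 4 by rewrite divr_gt0.
have [N _ hN] := hl _ e2; exists N => m n Nm mn.
have Bxy k : rnorm (B k (x - y)) <= e / 4.
  apply: le_trans (hC _ _) _; rewrite rnormC.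
  apply: (@le_trans _ _ ((`|C| + 1) * rnorm (y - x))).
    by rewrite ler_wpM2r ?rnorm_ge0// (le_trans (ler_norm _))// lerDl.
  by rewrite mulrC -ler_pdivlMr.
have h1 := hN m Nm; have h2 := hN n (leq_trans Nm mn).
have -> : B n x - B m x = (B n (x - y) - B m (x - y)) + ((B n y - l) - (B m y - l)).
  by rewrite !(linsub (linB _)); zmod.
apply: le_trans (ler_rnormD _ _) _.
have := ler_rnormB (B n (x - y)) (B m (x - y)); have := ler_rnormB (B n y - l) (B m y - l).
have := Bxy m; have := Bxy n; move: h1 h2 => /=; lra.
Qed.

End Limits.

(** * Uniqueness of solutions *)

Section Solutions.
Context {R : realType} {X : completeNormedModType R[i]}.
Variables (T w : R) (D : set X) (A : R -> X -> X) (G : R -> R -> X -> X).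
Hypothesis HG : forall a, 0 <= a <= T -> qgroup w D (A a) (G a).

Definition deriv_within (x : R -> X) (t : R) (dx : X) :=
  forall e : R, 0 < e -> exists2 d : R, 0 < d &
    forall s, 0 <= s <= T -> `|s - t| < d ->
      rnorm (x s - x t - (s - t) *:r dx) <= e * `|s - t|.

Lemma deriv_withinB x1 x2 t d1 d2 : deriv_within x1 t d1 -> deriv_within x2 t d2 ->
  deriv_within (fun s => x1 s - x2 s) t (d1 - d2).
Proof.
move=> h1 h2 e e0; have e20 : 0 < e / 2 by rewrite divr_gt0.
have [r1 r10 H1] := h1 _ e20; have [r2 r20 H2] := h2 _ e20.
exists (Num.min r1 r2); first by rewrite lt_min r10.
move=> s sT; rewrite lt_min => /andP[/(H1 s sT) k1 /(H2 s sT) k2].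
have -> : x1 s - x2 s - (x1 t - x2 t) - (s - t) *:r (d1 - d2) =
   (x1 s - x1 t - (s - t) *:r d1) - (x2 s - x2 t - (s - t) *:r d2).
  by rewrite scalerBr; zmod.
by apply: le_trans (ler_rnormB _ _) _; lra.
Qed.

(* Locally a solution differs from an orbit of the group generated by the frozen
   A t by o(s - t), whence a two-sided Gronwall estimate. *)
Lemma solution_unique x s t : 0 <= s <= T -> 0 <= t <= T ->
  (forall r, 0 <= r <= T -> D (x r)) ->
  (forall r, 0 <= r <= T -> deriv_within x r (A r (x r))) -> x s = 0 -> x t = 0.
Proof.
move=> sT tT Dx dx xs.
have w0 := qg_ge0 (HG sT).
pose phi r := rnorm (x r).
have E1 h : 0 <= h -> 1 <= expR (w * h) by move=> h0; rewrite -expR0 ler_expR mulr_ge0.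
(* The slack e makes the estimate provable locally and stable under concatenation; both directions
   are kept because t may lie on either side of s. *)
suff H (e : R) : 0 < e -> forall a b, 0 <= a -> a <= b -> b <= T ->
    phi a <= expR (w * (b - a)) * (phi b + e * (b - a)) /\
    phi b <= expR (w * (b - a)) * (phi a + e * (b - a)).
  apply/rnorm_eq0/eqP; rewrite eq_le rnorm_ge0 andbT.
  apply/ler_addgt0Pr => e e0; rewrite add0r.
  pose K := expR (w * `|t - s|) * (`|t - s| + 1).
  have K0 : 0 < K by rewrite mulr_gt0 ?expR_gt0// ltr_wpDl.
  have e'0 : 0 < e / K by rewrite divr_gt0.
  have phis : phi s = 0 by rewrite /phi xs rnorm0.
  have : phi t <= expR (w * `|t - s|) * (e / K * `|t - s|).
    case/andP: sT => s0 sT; case/andP: tT => t0 tT; case: (leP s t) => st.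
      by have [_] := H _ e'0 s t s0 st tT; rewrite phis add0r ger0_norm ?subr_ge0.
    have [] := H _ e'0 t s t0 (ltW st) sT.
    by rewrite phis add0r ltr0_norm ?subr_lt0// opprB.
  move=> /le_trans; apply; rewrite -[leRHS](divfK (lt0r_neq0 K0)) -/K /K mulrCA.
  by rewrite ler_pM2l// ler_pM2l ?expR_gt0// lerDl.
move=> e0 a b a0 ab bT.
pose P p q := phi p <= expR (w * (q - p)) * (phi q + e * (q - p)) /\
    phi q <= expR (w * (q - p)) * (phi p + e * (q - p)).
have Ptrans p q r : p <= q -> q <= r -> P p q -> P q r -> P p r.
  move=> pq qr [h1 h2] [h3 h4].
  have -> : P p r = (phi p <= expR (w * (q - p)) * expR (w * (r - q)) * (phi r + (e * (q - p) + e * (r - q))) /\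
      phi r <= expR (w * (q - p)) * expR (w * (r - q)) * (phi p + (e * (q - p) + e * (r - q)))).
    rewrite /P -expRD -!mulrDr.
    by rewrite (_ : q - p + (r - q) = r - p)//; ring.
  have F1 := E1 (q - p); have F2 := E1 (r - q).
  rewrite subr_ge0 in F1; rewrite subr_ge0 in F2.
  have {}F1 := F1 pq; have {}F2 := F2 qr.
  have g1 : 0 <= e * (q - p) by rewrite mulr_ge0 ?subr_ge0// ltW.
  have g2 : 0 <= e * (r - q) by rewrite mulr_ge0 ?subr_ge0// ltW.
  move: F1 F2 h1 h2 h3 h4; set E := expR _; set F := expR _ => F1 F2 h1 h2 h3 h4.
  have E0 : 0 <= E by lra. have F0 : 0 <= F by lra.
  split.
    apply: le_trans h1 _; rewrite -mulrA ler_wpM2l//.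
    have : phi q + e * (q - p) <= F * (phi r + e * (r - q)) + F * (e * (q - p)).
      by apply: lerD => //; rewrite ler_peMl.
    lra.
  apply: le_trans h4 _; rewrite (mulrC E) -mulrA ler_wpM2l//.
  have : phi q + e * (r - q) <= E * (phi p + e * (q - p)) + E * (e * (r - q)).
    by apply: lerD => //; rewrite ler_peMl.
  lra.
apply: (@cousin _ P) => // [p q r _ pq qr _|c ac cb]; first exact: Ptrans.
have cT : 0 <= c <= T by rewrite (le_trans a0)// (le_trans cb).
have Hc := HG cT.
have e20 : 0 < e / 2 by rewrite divr_gt0.
have [d1 d10 H1] := dx c cT _ e20.
have [d2 d20 H2] := qg_gen Hc (Dx c cT) e20.
have loc q : 0 <= q <= T -> `|q - c| < Num.min d1 d2 ->
    phi q <= expR (w * `|q - c|) * (phi c + e * `|q - c|) /\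
    phi c <= expR (w * `|q - c|) * (phi q + e * `|q - c|).
  move=> qT; rewrite lt_min => /andP[/(H1 q qT) k1 /H2 k2].
  (* Both curves leave x c with the same derivative [A c (x c)]. *)
  have k : rnorm (x q - G c (q - c) (x c)) <= e * `|q - c|.
    have -> : x q - G c (q - c) (x c) = (x q - x c - (q - c) *:r A c (x c)) -
       (G c (q - c) (x c) - x c - (q - c) *:r A c (x c)) by zmod.
    by apply: le_trans (ler_rnormB _ _) _; lra.
  have F := E1 _ (normr_ge0 (q - c)); split.
    have : phi q <= rnorm (x q - G c (q - c) (x c)) + expR (w * `|q - c|) * phi c.
      rewrite /phi -{1}(subrK (G c (q - c) (x c)) (x q)).
      apply: le_trans (ler_rnormD _ _) _; rewrite lerD2l; exact: (qg_bound Hc).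
    have : 0 <= e * `|q - c| by rewrite mulr_ge0// ltW.
    rewrite mulrDr; nra.
  have -> : phi c = rnorm (G c (c - q) (G c (q - c) (x c))).
    by rewrite -(opprB q) (qg_NK Hc).
  apply: le_trans (qg_bound Hc _ _) _; rewrite distrC ler_wpM2l ?expR_ge0//.
  have -> : G c (q - c) (x c) = x q - (x q - G c (q - c) (x c)) by zmod.
  apply: le_trans (ler_rnormB _ _) _; by rewrite lerD2l.
exists (Num.min d1 d2); first by rewrite lt_min d10.
move=> p q ap pc cq qb dp dq.
have pT : 0 <= p <= T by rewrite (le_trans a0)// (le_trans pc) ?(le_trans cb).
have qT : 0 <= q <= T by rewrite (le_trans qb)// andbT (le_trans a0)// (le_trans ac).
have lp := loc p pT; have lq := loc q qT.
rewrite ler0_norm ?subr_le0// opprB in lp; rewrite ger0_norm ?subr_ge0// in lq.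
apply: (Ptrans p c q) => //.
  by apply: lp; rewrite ltrBlDr -ltrBlDl.
by have [] := lq; [rewrite ltrBlDl|split].
Qed.

End Solutions.

Section GraphNormLimits.
Context {R : realType} {X : completeNormedModType R[i]}.
Variables (w : R) (D : set X) (A : X -> X) (G : R -> X -> X).
Hypothesis HG : qgroup w D A G.
Hypothesis UC : uniformly_convex X.

Lemma graph_norm_lsc (u : nat -> X) l (M : R) : tends u l ->
  (\forall n \near \oo, D (u n) /\ graph_norm A (u n) <= M) ->
  D l /\ graph_norm A l <= M.
Proof.
move=> ul hu; have [Dl _] : D l /\ rnorm (A l) <= M.
  apply: (tends_dom HG UC ul); apply: filterS hu => n [Du hn]; split => //.
  by apply: le_trans hn; rewrite lerDr rnorm_ge0.
split => //; apply/ler_addgt0Pr => e e0.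
(* The norms of u n converge to that of l, so the bound on the sum leaves this bound for the second
   summand. *)
suff : rnorm (A l) <= M - rnorm l + e by rewrite /graph_norm; lra.
apply: (gen_lsc HG ul) Dl; near=> n.
have [Du hn] : D (u n) /\ graph_norm A (u n) <= M by near: n.
have h : rnorm (u n - l) <= e by near: n; exact: ul.
split=> //; have := lerB_rnorm l (u n); rewrite rnormC.
by move: hn; rewrite /graph_norm; lra.
Unshelve. all: by end_near.
Qed.

End GraphNormLimits.

Section Evolution.
Context {R : realType} {X : completeNormedModType R[i]}.
Variables (T w : R) (D : set X) (A : R -> X -> X) (G : R -> R -> X -> X) (v : R -> R).
Hypothesis T0 : 0 < T.
Hypothesis HG : forall a, 0 <= a <= T -> qgroup w D (A a) (G a).
Hypothesis UC : uniformly_convex X.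
Hypothesis vmono : {homo v : a b / a <= b}.
Hypothesis vcont : forall t (e : R), 0 < e -> exists2 d : R, 0 < d &
  forall s, `|s - t| < d -> `|v s - v t| <= e.
Local Notation gn a := (graph_norm (A a)).
Hypothesis HV : forall a b c y, 0 <= a <= T -> 0 <= b <= T -> 0 <= c <= T -> D y ->
  rnorm (A a y - A b y) <= `|v a - v b| * gn c y.

Let zT : 0 <= (0 : R) <= T. Proof. by rewrite lexx ltW. Qed.
Let w0 : 0 <= w. Proof. exact: qg_ge0 (HG zT). Qed.
Let T0' : 0 <= T. Proof. exact: ltW. Qed.

Let UN N t s := stepU G N 0 T t s.

Let UN_lin N t s : lin (UN N t s).
Proof. exact: (stepU_lin HG). Qed.

Let dist_le t s : 0 <= s <= T -> 0 <= t <= T -> `|t - s| <= T.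
Proof. by move=> /andP[? ?] /andP[? ?]; rewrite ler_norml; lra. Qed.

Let UN_bound N t s x : 0 <= s <= T -> 0 <= t <= T ->
  rnorm (UN N t s x) <= expR (w * T) * rnorm x.
Proof.
move=> sT tT; apply: le_trans (stepU_bound HG _ _ (lexx 0) (lexx T) sT tT) _.
by rewrite ler_wpM2r ?rnorm_ge0// ler_expR ler_wpM2l// dist_le.
Qed.

Let UN_cvg t s x : 0 <= s <= T -> 0 <= t <= T ->
  exists l, tends (fun N => UN N t s x) l.
Proof.
move=> sT tT; apply: (@tends_extend _ _ D (fun N => UN N t s)) => //.
- by move=> N z; exact: UN_bound.
- exact: (qg_dense (HG zT)).
move=> y Dy; pose K := (T - 0) * (v T - v 0) * expR (2 * w * `|t - s| + 4 * (v T - v 0)) * gn s y.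
apply: (@geometric_cvg _ _ _ K).
  by rewrite !mulr_ge0 ?expR_ge0 ?graph_norm_ge0// subr_ge0 ?vmono.
move=> N; apply: le_trans (stepU_refine HG vmono HV N (lexx 0) (lexx T) sT tT Dy) _.
by rewrite /K le_eqVlt; apply/orP; left; apply/eqP; ring.
Qed.

Definition limU t s x : X := xget 0 [set l | tends (fun N => UN N t s x) l].

Lemma limUP t s x : 0 <= s <= T -> 0 <= t <= T ->
  tends (fun N => UN N t s x) (limU t s x).
Proof. by move=> sT tT; have [l hl] := UN_cvg x sT tT; apply: xgetPex; exists l. Qed.

Lemma limU_lin t s : 0 <= s <= T -> 0 <= t <= T -> lin (limU t s).
Proof.
move=> sT tT a x y; apply: (tends_unique (limUP _ sT tT)).
rewrite (_ : (fun N => UN N t s (a *: x + y)) = (fun N => a *: UN N t s x + UN N t s y)).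
  apply: tendsD; last exact: limUP.
  apply: (@tends_lin _ _ ( *:%R a) _ _ (complex.Re `|a|)) (limUP _ sT tT).
    exact: lin_scale.
  move=> z; rewrite /rnorm normrZ (normE z).
  have -> : `|a| = (complex.Re `|a|)%:C%C by rewrite RRe_real// ger0_real.
  by rewrite -realcM.
by apply/funext => N; rewrite UN_lin.
Qed.

Lemma limU_bound t s x : 0 <= s <= T -> 0 <= t <= T ->
  rnorm (limU t s x) <= expR (w * T) * rnorm x.
Proof.
move=> sT tT; rewrite -[limU t s x]subr0; apply: tends_le (limUP _ sT tT) _.
by near=> N; rewrite subr0; exact: UN_bound.
Unshelve. all: by end_near.
Qed.

Lemma limU_id s x : 0 <= s <= T -> limU s s x = x.
Proof.
move=> sT; apply: (tends_unique (limUP _ sT sT)).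
rewrite (_ : (fun N => _) = fun=> x); first exact: tends_cst.
by apply/funext => N; rewrite /UN /stepU (prodGVK HG).
Qed.

Lemma limU_comp s r t x : 0 <= s <= T -> 0 <= r <= T -> 0 <= t <= T ->
  limU t r (limU r s x) = limU t s x.
Proof.
move=> sT rT tT; apply: (@tends_unique _ _ (fun N => UN N t s x)); last exact: limUP.
pose z := limU r s x; move=> e e0.
have E0 : 0 < e / 2 / expR (w * T) by rewrite !divr_gt0 ?expR_gt0.
near=> N.
have h1 : rnorm (UN N t r z - limU t r z) <= e / 2.
  by near: N; apply: limUP => //; rewrite divr_gt0.
have h2 : rnorm (UN N r s x - z) <= e / 2 / expR (w * T).
  by near: N; apply: limUP.
have -> : UN N t s x = UN N t r (UN N r s x) by rewrite /UN (stepU_comp HG).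
apply: le_trans (ler_rdistD (UN N t r z) _ _) _.
have := UN_bound N (UN N r s x - z) rT tT; rewrite (linsub (UN_lin N t r)).
move: h2; rewrite ler_pdivlMr ?expR_gt0// mulrC => h2 h3; have := le_trans h3 h2.
rewrite -/z; lra.
Unshelve. all: by end_near.
Qed.

Let near_cell (d : R) : 0 < d -> \forall N \near \oo, (T - 0) * dy N <= d.
Proof.
move=> d0; apply: filterS (near_dy (divr_gt0 d0 T0)) => N.
by rewrite subr0 ler_pdivlMr// mulrC.
Qed.

(** The excess sits on one cell to the left of [min t s], so it vanishes with the mesh by continuity
    of [v] at that point. *)
Lemma limU_graph_norm t s y (e : R) : 0 <= s <= T -> 0 <= t <= T -> D y -> 0 < e ->
  D (limU t s y) /\
  gn t (limU t s y) <= expR (w * `|t - s| + `|v t - v s| + e) * gn s y.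
Proof.
move=> sT tT Dy e0; apply: (graph_norm_lsc (HG tT) UC (limUP _ sT tT)).
have e20 : 0 < e / 2 by rewrite divr_gt0.
have [d d0 hd] := vcont (Num.min t s) e20.
have d20 : 0 < d / 2 by rewrite divr_gt0.
near=> N; split; first exact: (stepU_dom HG).
have h : (T - 0) * dy N <= d / 2 by near: N; exact: near_cell.
apply: le_trans (stepU_graph_norm HG vmono HV N (lexx 0) (lexx T) sT tT Dy) _.
rewrite ler_wpM2r ?graph_norm_ge0// ler_expR lerD2l /cell_excess.
have H0 : 0 <= (T - 0) * dy N by rewrite subr0 mulr_ge0// ltW// dy_gt0.
set q := Num.min t s in hd *; have q0 : 0 <= q.
  by rewrite /q le_min; case/andP: sT => -> _; case/andP: tT => ->.
set p := Num.max _ _.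
have pq : p <= q by rewrite /p ge_max q0 gerBl.
have qp : q - p <= d / 2 by have : q - (T - 0) * dy N <= p; [rewrite /p le_max lexx orbT|lra].
have := hd p; rewrite ler0_norm ?subr_le0// opprB => /(_ _) hp.
have : `|v p - v q| <= e / 2 by apply: hp; lra.
by rewrite ler_norml; lra.
Unshelve. all: by end_near.
Qed.

(** Near the diagonal U(t,s) is compared with the group of [A s], which has this derivative; the
    cocycle identity carries the result to other times in [limU_solution]. *)
Lemma limU_deriv s y : 0 <= s <= T -> D y ->
  deriv_within T (fun t => limU t s y) s (A s y).
Proof.
move=> sT Dy e e0; have e20 : 0 < e / 2 by rewrite divr_gt0.
have [d1 d10 h1] := qg_gen (HG sT) Dy e20.
pose K := expR (2 * w * T) * (gn s y + 1).
have K0 : 0 < K by rewrite mulr_gt0 ?expR_gt0// ltr_wpDl// graph_norm_ge0.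
have sg0 : 0 < e / 2 / K by rewrite divr_gt0.
have [d2 d20 h2] := vcont s sg0.
exists (Num.min d1 (d2 / 2)); first by rewrite lt_min d10 divr_gt0.
move=> t tT; rewrite lt_min => /andP[/h1 k1 td].
have k2 : rnorm (limU t s y - G s (t - s) y) <= e / 2 * `|t - s|.
  apply: tends_le (limUP _ sT tT) _; near=> N.
  have h : (T - 0) * dy N <= d2 / 2 by near: N; apply: near_cell; rewrite divr_gt0.
  have dN : 0 < dy N :> R by exact: dy_gt0.
  have H0 : 0 <= (T - 0) * dy N by rewrite subr0 mulr_ge0// ltW.
  apply: le_trans (stepU_frozen HG HV (lexx 0) (lexx T) sT tT sT Dy (ltW sg0) _) _.
    (* Both |t - s| and the mesh are at most d2/2, so every freezing time involved is within d2 of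
       s. *)
    move=> r rT r1 r2; apply: h2; move: td r1 r2.
    rewrite !ltr_norml; case: (leP t s) => ts; lra.
  rewrite -mulrA [leRHS]mulrC ler_wpM2l//.
  have E2 : expR (2 * w * `|t - s|) <= expR (2 * w * T).
    by rewrite ler_expR ler_wpM2l ?mulr_ge0// dist_le.
  apply: (@le_trans _ _ (expR (2 * w * T) * (e / 2 / K * (gn s y + 1)))).
    apply: ler_pM => //; last by rewrite ler_pM2l// lerDl.
    by rewrite mulr_ge0 ?graph_norm_ge0// ltW.
  by rewrite mulrCA -/K divfK// gt_eqF.
rewrite /= limU_id//.
have -> : limU t s y - y - (t - s) *:r A s y =
  (limU t s y - G s (t - s) y) + (G s (t - s) y - y - (t - s) *:r A s y) by zmod.
by apply: le_trans (ler_rnormD _ _) _; lra.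
Unshelve. all: by end_near.
Qed.

Lemma limU_dom t s y : 0 <= s <= T -> 0 <= t <= T -> D y -> D (limU t s y).
Proof. by move=> sT tT Dy; have [] := limU_graph_norm sT tT Dy ltr01. Qed.

Lemma limU_solution s y : 0 <= s <= T -> D y -> forall t, 0 <= t <= T ->
  deriv_within T (fun t => limU t s y) t (A t (limU t s y)).
Proof.
move=> sT Dy t tT e /(limU_deriv tT (limU_dom sT tT Dy))[d d0 hd]; exists d => // r rT rd.
by have := hd r rT rd; rewrite /= limU_id// limU_comp.
Qed.

Lemma limU_cont1 t x (e : R) : 0 <= t <= T -> 0 < e -> exists2 d : R, 0 < d &
  forall r, 0 <= r <= T -> `|r - t| < d -> rnorm (limU r t x - x) <= e.
Proof.
move=> tT e0; pose C := expR (w * T) + 1; have C0 : 0 < C by rewrite addr_gt0 ?expR_gt0.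
have e'0 : 0 < e / 2 / C by rewrite !divr_gt0.
have [y Dy hy] := qg_dense (HG zT) x e'0.
have [d d0 hd] := limU_deriv tT Dy ltr01.
pose n := rnorm (A t y) + 1; have n0 : 0 < n by rewrite ltr_wpDl ?rnorm_ge0.
exists (Num.min d (e / 2 / n)); first by rewrite lt_min d0 !divr_gt0.
move=> r rT; rewrite lt_min => /andP[/(hd r rT) k1 k2].
rewrite /= limU_id// in k1.
have k3 : rnorm (limU r t y - y) <= e / 2.
  rewrite -(subrK ((r - t) *:r A t y) (limU r t y - y)).
  apply: le_trans (ler_rnormD _ _) _; rewrite rnormZ.
  move: k2; rewrite ltr_pdivlMr// /n; lra.
have -> : limU r t x - x = (limU r t (x - y) - (x - y)) + (limU r t y - y).
  by rewrite (linsub (limU_lin tT rT)); zmod.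
apply: le_trans (ler_rnormD _ _) _.
have k4 : rnorm (limU r t (x - y) - (x - y)) <= e / 2.
  apply: le_trans (ler_rnormB _ _) _.
  apply: (@le_trans _ _ (C * rnorm (y - x))).
    by rewrite mulrDl mul1r (rnormC y) lerD2r limU_bound.
  by rewrite mulrC -ler_pdivlMr.
lra.
Qed.

Lemma limU_cont t0 s0 x (e : R) : 0 <= t0 <= T -> 0 <= s0 <= T -> 0 < e ->
  exists2 d : R, 0 < d & forall t s, 0 <= t <= T -> 0 <= s <= T ->
    `|t - t0| < d -> `|s - s0| < d -> rnorm (limU t s x - limU t0 s0 x) <= e.
Proof.
move=> t0T s0T e0; pose E := expR (w * T); have E0 : 0 < E by exact: expR_gt0.
have e20 : 0 < e / 2 by rewrite divr_gt0.
have e'0 : 0 < e / 2 / (E * E) by rewrite divr_gt0// mulr_gt0.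
have [d1 d10 h1] := limU_cont1 (limU t0 s0 x) t0T e20.
have [d2 d20 h2] := limU_cont1 x s0T e'0.
exists (Num.min d1 d2); first by rewrite lt_min d10.
move=> t s tT sT; rewrite !lt_min => /andP[/(h1 t tT) k1 _] /andP[_ /(h2 s sT) k2].
have k3 : rnorm (limU s0 s x - x) <= E * (e / 2 / (E * E)).
  (* Invertibility turns continuity in the first time variable into continuity in the second. *)
  have -> : limU s0 s x - x = limU s0 s (x - limU s s0 x).
    by rewrite (linsub (limU_lin sT s0T)) limU_comp// limU_id.
  apply: le_trans (limU_bound _ sT s0T) _.
  by rewrite rnormC ler_pM2l.
have -> : limU t s x - limU t0 s0 x = limU t s0 (limU s0 s x - x) +
    (limU t t0 (limU t0 s0 x) - limU t0 s0 x).
  by rewrite (linsub (limU_lin s0T tT)) !limU_comp//; zmod.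
apply: le_trans (ler_rnormD _ _) _; rewrite [leRHS]splitr; apply: lerD => //.
apply: le_trans (limU_bound _ s0T tT) _.
rewrite -/E; apply: le_trans (ler_wpM2l (ltW E0) k3) _.
by rewrite le_eqVlt; apply/orP; left; apply/eqP; field; rewrite gt_eqF.
Qed.

Lemma limU_gen_cont s y t0 (e : R) : 0 <= s <= T -> D y -> 0 <= t0 <= T -> 0 < e ->
  exists2 d : R, 0 < d & forall t, 0 <= t <= T -> `|t - t0| < d ->
    rnorm (A t (limU t s y) - A t0 (limU t0 s y)) <= e.
Proof.
move=> sT Dy t0T e0.
(* By the cocycle identity the solution may be restarted at t0 from U(t0,s)y. *)
wlog : s y sT Dy / s = t0 => [H|st].
  have [d d0 hd] := H t0 (limU t0 s y) t0T (limU_dom sT t0T Dy) erefl.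
  exists d => // t tT td; have := hd t tT td.
  by rewrite limU_comp// limU_id.
rewrite {}st {s} in sT *; rewrite limU_id//.
(* [gen_tends] is about sequences, so a failure of continuity is turned into times u n tending to
   t0. *)
apply: contrapT => /forall2NP hN.
have /choice[u hu] : forall n : nat, exists r : R, [/\ 0 <= r <= T, `|r - t0| < dy n &
    e < rnorm (A r (limU r t0 y) - A t0 y)].
  move=> n; have [|/existsNP[r]] := hN (dy n); first by rewrite dy_gt0.
  move=> /not_implyP[rT /not_implyP[rd /negP]]; rewrite -ltNge => re.
  by exists r.
pose z n := limU (u n) t0 y.
have uT n : 0 <= u n <= T by have [] := hu n.
have Dz n : D (z n) by apply: limU_dom.
have near_u (d : R) : 0 < d -> \forall n \near \oo, `|u n - t0| < d.
  move=> d0; apply: filterS (near_dy d0) => n; apply: lt_le_trans.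
  by have [] := hu n.
have zy : tends z y.
  move=> e1 e10; have [d d0 hd] := limU_cont1 y t0T e10.
  by apply: filterS (near_u d d0) => n; exact: hd.
have gz (e1 : R) : 0 < e1 -> \forall n \near \oo, gn t0 (z n) <= gn t0 y + e1.
  move=> e10; have [d d0 hd] := expR_small (gn t0 y) e10.
  (* Four quarters of d: the growth w|u n - t0|, the variation of [v] in the graph norm bound, the
     slack of that bound, and the change from n_(u n) to n_t0. *)
  have d40 : 0 < d / 4 by rewrite divr_gt0.
  have [d1 d10 hd1] := vcont t0 d40.
  have d5 : 0 < d / 4 / (w + 1) by rewrite divr_gt0// ltr_wpDl.
  near=> n.
  have k1 : `|v (u n) - v t0| <= d / 4 by apply: hd1; near: n; exact: near_u.
  have k2 : `|u n - t0| < d / 4 / (w + 1) by near: n; exact: near_u.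
  have [_ k3] := limU_graph_norm t0T (uT n) Dy d40.
  have k4 := graph_norm_change HV t0T (uT n) (Dz n).
  apply: le_trans k4 _; apply: le_trans (ler_wpM2l (expR_ge0 _) k3) _.
  rewrite mulrA -expRD.
  have gE : `|gn t0 y| = gn t0 y by rewrite ger0_norm ?graph_norm_ge0.
  rewrite -{1}gE -[X in _ <= X + _]gE; apply: hd.
  have : w * `|u n - t0| <= d / 4.
    move: k2; rewrite ltr_pdivlMr ?ltr_wpDl// => k2.
    have := normr_ge0 (u n - t0); lra.
  rewrite (distrC (v t0)); lra.
have AZ : tends (A t0 \o z) (A t0 y).
  apply: (gen_tends (HG t0T) UC) => // e1 e10.
  have e20 : 0 < e1 / 2 by rewrite divr_gt0.
  near=> n.
  have k1 : gn t0 (z n) <= gn t0 y + e1 / 2 by near: n; exact: gz.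
  have k2 : rnorm (z n - y) <= e1 / 2 by near: n; exact: zy.
  have := lerB_rnorm y (z n); rewrite rnormC.
  by move: k1; rewrite /graph_norm; lra.
have g1 : 0 < gn t0 y + 1 by rewrite ltr_wpDl ?graph_norm_ge0.
have e20 : 0 < e / 2 by rewrite divr_gt0.
have e3 : 0 < e / 2 / (gn t0 y + 1) by rewrite divr_gt0.
(* [AZ] concerns the fixed operator [A t0]; passing to [A (u n)] costs an increment of [v] times the
   bounded norms n_t0(z n). *)
have [d d0 hd] := vcont t0 e3.
near \oo => n.
have [_ _] := hu n; apply/negP; rewrite -leNgt.
have k1 : rnorm (A t0 (z n) - A t0 y) <= e / 2 by near: n; exact: AZ.
have k2 : gn t0 (z n) <= gn t0 y + 1 by near: n; exact: gz.
have k3 : `|v (u n) - v t0| <= e / 2 / (gn t0 y + 1) by apply: hd; near: n; exact: near_u.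
have k4 := HV (uT n) t0T t0T (Dz n).
apply: le_trans (ler_rdistD (A t0 (z n)) _ _) _; rewrite -/(z n).
have : `|v (u n) - v t0| * gn t0 (z n) <= e / 2.
  apply: (@le_trans _ _ (e / 2 / (gn t0 y + 1) * (gn t0 y + 1))).
    by apply: ler_pM; rewrite ?graph_norm_ge0.
  by rewrite divfK// gt_eqF.
lra.
Unshelve. all: by end_near.
Qed.

End Evolution.

(** * The hypotheses in terms of operator bounds *)

Section Conversions.
Context {R : realType} {X : normedModType R[i]}.

Lemma quotientP (k e : R) (z d : X) : k != 0 ->
  (rnorm ((k^-1)%:C%C *: z - d) <= e) = (rnorm (z - k *:r d) <= e * `|k|).
Proof.
move=> k0; have -> : z - k *:r d = k *:r ((k^-1)%:C%C *: z - d).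
  by rewrite scalerBr rscalerA mulfV// rscale1r.
by rewrite rnormZ mulrC ler_pM2r// normr_gt0.
Qed.

Lemma rderivP (G : R -> X -> X) x d : G 0 x = x ->
  ((h^-1)%:C%C *: (G h x - x) @[h --> 0^'] --> d) <-> rderiv G x d.
Proof.
move=> G0; split.
- move=> /rcvgP hd e /hd/nbhs_ballP[r /= r0 hr]; exists r => // h hr'.
  have [->|h0] := eqVneq h 0.
    by rewrite G0 subrr rscale0r subrr rnorm0 normr0 mulr0.
  by rewrite -quotientP//; apply: hr => //; rewrite /ball/= sub0r normrN.
- move=> hd; apply/rcvgP => e /hd[r r0 hr]; apply/nbhs_ballP; exists r => //= h.
  by rewrite /ball/= sub0r normrN => hh h0; rewrite quotientP//; exact: hr.
Qed.

Lemma has_derivative_onP (T : R) (x dx : R -> X) :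
  has_derivative_on T x dx <->
  forall t, 0 <= t <= T -> forall e : R, 0 < e -> exists2 d : R, 0 < d &
    forall s, 0 <= s <= T -> `|s - t| < d ->
      rnorm (x s - x t - (s - t) *:r dx t) <= e * `|s - t|.
Proof.
split=> hd t.
- move=> tT e e0; have := hd t; rewrite in_itv/= => /(_ tT)/rcvgP/(_ e e0).
  move=> /nbhs_ballP[r /= r0 hr]; exists r => // s sT sr.
  have [->|st] := eqVneq s t.
    by rewrite !subrr rscale0r subrr rnorm0 normr0 mulr0.
  rewrite -quotientP ?subr_eq0//; apply: hr => //; first by rewrite /ball/= distrC.
- rewrite in_itv/= => tT; apply/rcvgP => e /(hd t tT)[r r0 hr].
  apply/nbhs_ballP; exists r => //= s; rewrite /ball/= distrC => sr st.
  by rewrite in_itv/= => sT; rewrite quotientP ?subr_eq0//; exact: hr.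
Qed.

Lemma within_itv_cvgP (T : R) (f : R -> X) t l :
  (f @ within `[0, T] (nbhs t) --> l) <->
  forall e : R, 0 < e -> exists2 d : R, 0 < d &
    forall s, 0 <= s <= T -> `|s - t| < d -> rnorm (f s - l) <= e.
Proof.
split.
- move=> /rcvgP hf e /hf/nbhs_ballP[r /= r0 hr]; exists r => // s sT sr.
  by apply: hr; rewrite /= ?in_itv//= /ball/= distrC.
- move=> hf; apply/rcvgP => e /hf[r r0 hr]; apply/nbhs_ballP; exists r => //= s.
  by rewrite /ball/= distrC => sr; rewrite in_itv/= => sT; exact: hr.
Qed.

Variables (D : set X) (n : X -> R) (B : X -> X).
Hypothesis D0 : D 0.
Hypothesis n0 : n 0 = 0.

Lemma opnorm_bound (C : R) : 0 <= C -> (forall y, D y -> rnorm (B y) <= C * n y) ->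
  (opnorm D n B <= C%:E)%E.
Proof.
move=> C0 hB; apply: ge_ereal_sup => _ [y [Dy ny] <-]; rewrite lee_fin.
by apply: le_trans (hB y Dy) _; rewrite ler_piMr.
Qed.

Lemma opnorm_ge0 : (0 <= opnorm D n B)%E.
Proof.
apply: (@le_trans _ _ (rnorm (B 0))%:E); first by rewrite lee_fin rnorm_ge0.
by apply: ereal_sup_ubound; exists 0 => //; split => //; rewrite n0 ler01.
Qed.

Hypothesis DZ : forall a y, D y -> D (a *:r y).
Hypothesis nZ : forall a y, D y -> n (a *:r y) = `|a| * n y.
Hypothesis n_ge : forall y, rnorm y <= n y.
Hypothesis BZ : forall a y, D y -> B (a *:r y) = a *:r B y.

Lemma opnorm_le (C : R) y : (opnorm D n B <= C%:E)%E -> D y -> rnorm (B y) <= C * n y.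
Proof.
move=> hC Dy; have := le_trans (rnorm_ge0 y) (n_ge y).
rewrite le_eqVlt => /orP[/eqP ny|ny].
  have y0 : y = 0 by apply: rnorm_eq0; apply/eqP; rewrite eq_le rnorm_ge0 ny n_ge.
  by rewrite -ny mulr0 -[y](rscale1r y) y0 -(rscale0r 0) rscalerA mulr0 BZ// rscale0r rnorm0.
have : ((rnorm (B ((n y)^-1 *:r y)))%:E <= C%:E)%E.
  apply: le_trans hC; apply: ereal_sup_ubound; exists ((n y)^-1 *:r y) => //; split.
    exact: DZ.
  by rewrite nZ// gtr0_norm ?invr_gt0// mulVf// gt_eqF.
rewrite lee_fin BZ// rnormZ gtr0_norm ?invr_gt0// mulrC ler_pdivrMr//.
Qed.

Lemma opnorm_fine_le y : (opnorm D n B < +oo)%E -> D y ->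
  rnorm (B y) <= fine (opnorm D n B) * n y.
Proof.
by move=> h; apply: opnorm_le; rewrite fineK// ge0_fin_numE// opnorm_ge0.
Qed.

Lemma fine_opnorm_le (C : R) : 0 <= C -> (forall y, D y -> rnorm (B y) <= C * n y) ->
  fine (opnorm D n B) <= C.
Proof.
move=> C0 hB; have hC := opnorm_bound C0 hB.
rewrite -lee_fin fineK// ge0_fin_numE ?opnorm_ge0//.
by apply: le_lt_trans hC _; rewrite ltry.
Qed.

End Conversions.

(** * From the assumptions on A to the control function *)

Section Hypotheses.
Context {R : realType} {X : completeNormedModType R[i]}.
Variables (T omega : R) (D : set X) (A : R -> X -> X) (expA : R -> R -> X -> X).
Hypothesis hT : 0 < T.
Hypothesis hX : uniformly_convex X.
Hypothesis hgroup : forall t : R, t \in `[0, T] -> strongly_continuous_group (expA t).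
Hypothesis hgen : forall t : R, t \in `[0, T] -> is_generator D (A t) (expA t).
Hypothesis hbound : forall t s : R, t \in `[0, T] ->
    (opnorm setT (@rnorm R X) (expA t s) <= (expR (omega * `|s|))%:E)%E.
Hypothesis hLYX : forall t : R, t \in `[0, T] ->
    bounded_operator D (graph_norm (A 0)) (A t).
Hypothesis hcont : opnorm_continuous D (graph_norm (A 0)) T A.
Hypothesis hbv : opnorm_bounded_variation D (graph_norm (A 0)) T A.

Local Notation w := (`|omega|).
Local Notation n0 := (graph_norm (A 0)).

(** Replacing omega by |omega| weakens the bound and makes the rate nonnegative. *)
Lemma expA_qgroup t : 0 <= t <= T -> qgroup w D (A t) (expA t).
Proof.
move=> tT; have tI : t \in `[0, T] by rewrite in_itv.
have [gb g0 gD gc] := hgroup tI; have [gd gg] := hgen tI.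
have glin s : lin (expA t s).
  by move=> a x y; have [h _] := gb s; exact: h.
split=> //.
- move=> s x; apply: (@opnorm_le _ _ setT (@rnorm R X)) => //.
  + by move=> a y _; exact: rnormZ.
  + by move=> a y _; rewrite (linZ (glin s)).
  + apply: le_trans (hbound s tI) _; rewrite lee_fin ler_expR.
    by rewrite ler_wpM2r// ler_norm.
- move=> x e e0; have /rcvgP := gc x 0; rewrite g0 => /(_ e e0)/nbhs_ballP[d /= d0 hd].
  by exists d => // s sd; apply: hd; rewrite /ball/= sub0r normrN.
- by move=> y u /(rderivP _ (g0 y)) hu; apply/gd; exists u.
- by move=> y Dy; apply/(rderivP _ (g0 y)); exact: gg.
Qed.

Let zT : 0 <= (0 : R) <= T. Proof. by rewrite lexx ltW. Qed.
Let H0 := expA_qgroup zT.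
Let D0 : D 0 := dom0 H0.
Let n00 : n0 0 = 0.
Proof. by rewrite /graph_norm (gen0 H0) rnorm0 addr0. Qed.
Let DZ : forall a y, D y -> D (a *:r y). Proof. by move=> a y Dy; exact: (domZ H0). Qed.
Let nZ : forall a y, D y -> n0 (a *:r y) = `|a| * n0 y.
Proof. by move=> a y Dy; rewrite /graph_norm (genZ H0)// !rnormZ mulrDr. Qed.
Let n_ge : forall y, rnorm y <= n0 y.
Proof. by move=> y; rewrite lerDl rnorm_ge0. Qed.

(** Since [fine] sends +oo to 0, this is the operator norm only by [diff_fin], which rests on the
    boundedness of each [A t] on Y. *)
Definition jump s t : R := fine (opnorm D n0 (A t \- A s)%R).

Let diffZ s t a y : 0 <= s <= T -> 0 <= t <= T -> D y ->
  (A t \- A s) (a *:r y) = a *:r (A t \- A s) y.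
Proof.
move=> sT tT Dy; rewrite /= (genZ (expA_qgroup sT))// (genZ (expA_qgroup tT))//.
by rewrite scalerBr.
Qed.

Let A_bound t : 0 <= t <= T -> exists2 C : R, 0 <= C & forall y, D y -> rnorm (A t y) <= C * n0 y.
Proof.
move=> tT; have [_ hb] := hLYX (t := t) ltac:(by rewrite in_itv).
exists (fine (opnorm D n0 (A t))); first by rewrite fine_ge0// opnorm_ge0.
move=> y Dy; apply: opnorm_fine_le => // a z Dz; exact: (genZ (expA_qgroup tT)).
Qed.

Let diff_fin s t : 0 <= s <= T -> 0 <= t <= T -> (opnorm D n0 (A t \- A s)%R < +oo)%E.
Proof.
move=> sT tT; have [C1 C10 h1] := A_bound sT; have [C2 C20 h2] := A_bound tT.
apply: (@le_lt_trans _ _ (C2 + C1)%:E); last by rewrite ltry.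
apply: opnorm_bound; first exact: addr_ge0.
move=> y Dy; apply: le_trans (ler_rnormB _ _) _.
by rewrite mulrDl lerD ?h1 ?h2.
Qed.

Lemma jump_le s t y : 0 <= s <= T -> 0 <= t <= T -> D y ->
  rnorm (A t y - A s y) <= jump s t * n0 y.
Proof.
move=> sT tT Dy; apply: (@opnorm_fine_le _ _ D n0 (A t \- A s)) => //.
  by move=> a z Dz; exact: diffZ.
exact: diff_fin.
Qed.

Lemma jump_min s t (C : R) : 0 <= C ->
  (forall y, D y -> rnorm (A t y - A s y) <= C * n0 y) -> jump s t <= C.
Proof. by move=> C0 h; apply: fine_opnorm_le. Qed.

Lemma jump_ge0 s t : 0 <= jump s t.
Proof. by rewrite fine_ge0// opnorm_ge0. Qed.

Lemma jump_triangle a t b : 0 <= a <= T -> 0 <= t <= T -> 0 <= b <= T ->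
  jump a b <= jump a t + jump t b.
Proof.
move=> aT tT bT; apply: jump_min; first by rewrite addr_ge0 ?jump_ge0.
move=> y Dy; apply: le_trans (ler_rdistD (A t y) _ _) _.
by rewrite mulrDl addrC lerD ?jump_le.
Qed.

Lemma jumpC s t : 0 <= s <= T -> 0 <= t <= T -> jump s t <= jump t s.
Proof.
move=> sT tT; apply: jump_min; first exact: jump_ge0.
by move=> y Dy; rewrite rnormC; exact: jump_le.
Qed.

Lemma jump_small t (e : R) : 0 <= t <= T -> 0 < e -> exists2 d : R, 0 < d &
  forall s, 0 <= s <= T -> `|s - t| < d -> jump s t <= e /\ jump t s <= e.
Proof.
move=> tT e0; have := hcont (t := t) ltac:(by rewrite in_itv).
move=> /fine_cvgP[_] /cvgr_le/(_ e e0)/nbhs_ballP[d /= d0 hd]; exists d => // s sT sd.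
have h : jump t s <= e by apply: hd; rewrite /= ?in_itv//= /ball/= distrC.
by split=> //; apply: le_trans (jumpC sT tT) h.
Qed.

Lemma sum_jump a s : 0 <= a -> itv_partition a T s ->
  (\sum_(0 <= i < size s) opnorm D n0
     (A (nth T (a :: s) i.+1) \- A (nth T (a :: s) i))%R = (chain_sum jump a s)%:E)%E.
Proof.
elim: s a => [|x s IH] a a0 hs; first by rewrite big_geq.
have hs' := itv_partition_cons hs; have xT := itv_partition_le hs'.
have ax : a < x by case: hs => /= /andP[].
have x0 : 0 <= x by rewrite (le_trans a0)// ltW.
rewrite [size _]/= big_nat_recl//= IH// EFinD; congr (_ + _)%E.
rewrite /jump fineK// ge0_fin_numE ?opnorm_ge0// diff_fin ?x0//.
by rewrite a0 (le_trans (ltW ax)).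
Qed.

(** The closed graph argument gives a constant at each t with no control in t. Norm continuity of A
    spreads it to a neighbourhood of t, and [cousin] makes it uniform. *)
Lemma graph_norm_equiv : exists2 C : R, 0 < C &
  forall t y, 0 <= t <= T -> D y -> n0 y <= C * graph_norm (A t) y.
Proof.
pose P p q := exists2 C : R, 0 < C &
  forall t y, p <= t <= q -> D y -> n0 y <= C * graph_norm (A t) y.
suff [C C0 h] : P 0 T by exists C.
apply: cousin; first exact: ltW.
  move=> p q r _ _ _ _ [C1 C10 h1] [C2 C20 h2]; exists (C1 + C2); first exact: addr_gt0.
  move=> t y /andP[pt tr] Dy; rewrite mulrDl; have [tq|/ltW qt] := leP t q.
    apply: le_trans (h1 t y _ Dy) _; first by rewrite pt.
    by rewrite lerDl mulr_ge0 ?graph_norm_ge0// ltW.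
  apply: le_trans (h2 t y _ Dy) _; first by rewrite qt.
  by rewrite lerDr mulr_ge0 ?graph_norm_ge0// ltW.
move=> t t0 tT; have tI : 0 <= t <= T by rewrite t0.
have [C C0 hC] := graph_norm_dominated H0 (expA_qgroup tI) hX.
pose K := C + 1; have K0 : 0 < K by rewrite ltr_wpDl.
have hK y : D y -> n0 y <= K * graph_norm (A t) y.
  move=> Dy; rewrite mulrDl mul1r {1}/graph_norm addrC lerD ?hC//.
  by rewrite lerDl rnorm_ge0.
(* With this threshold the perturbation contributes at most half of n_0(y), which is absorbed on the
   left and doubles the constant. *)
have e0 : 0 < (2 * K)^-1 by rewrite invr_gt0 mulr_gt0.
have [d d0 hd] := jump_small tI e0.
exists d => // p q p0 pt tq qT dp dq; exists (2 * K); first by rewrite mulr_gt0.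
move=> r y /andP[pr rq] Dy.
have rT : 0 <= r <= T by rewrite (le_trans p0)// (le_trans rq).
have rd : `|r - t| < d by rewrite ltr_norml; lra.
have [j1 _] := hd r rT rd.
have h1 : rnorm (A t y - A r y) <= (2 * K)^-1 * n0 y.
  apply: le_trans (jump_le rT tI Dy) _.
  by rewrite ler_wpM2r ?graph_norm_ge0.
have h2 : graph_norm (A t) y <= graph_norm (A r) y + (2 * K)^-1 * n0 y.
  by rewrite /graph_norm -addrA lerD2l; have := lerB_rnorm (A t y) (A r y); rewrite /graph_norm in h1; lra.
have := le_trans (hK y Dy) (ler_wpM2l (ltW K0) h2).
have E : K * ((2 * K)^-1 * n0 y) = n0 y / 2 by field; rewrite gt_eqF.
rewrite mulrDr E; lra.
Qed.

Lemma control : exists v : R -> R, [/\ {homo v : a b / a <= b},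
  forall t (e : R), 0 < e -> exists2 d : R, 0 < d &
    forall s, `|s - t| < d -> `|v s - v t| <= e &
  forall a b c y, 0 <= a <= T -> 0 <= b <= T -> 0 <= c <= T -> D y ->
    rnorm (A a y - A b y) <= `|v a - v b| * graph_norm (A c) y].
Proof.
have [M hM] := hbv.
have [v [vm vc vj]] : exists v : R -> R,
  [/\ {homo v : a b / a <= b},
      forall t (e : R), 0 < e -> exists2 d : R, 0 < d &
        forall s, `|s - t| < d -> `|v s - v t| <= e &
      forall a b, 0 <= a -> a < b -> b <= T -> jump a b <= v b - v a].
  apply: (@control_function _ T M jump) => //.
  - by move=> a b _ _ _; exact: jump_ge0.
  - move=> a t b a0 at_ tb bT; apply: jump_triangle.
    + by rewrite a0 (le_trans at_)// (le_trans tb).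
    + by rewrite (le_trans a0)// (le_trans tb).
    + by rewrite bT (le_trans a0)// (le_trans at_).
  - move=> s hs; rewrite -lee_fin -sum_jump//; exact: hM.
  - move=> t t0 tT e e0; have [d d0 hd] := jump_small (t := t) ltac:(by rewrite t0) e0.
    by exists d => // s s0 sT; apply: hd; rewrite s0.
have [C C0 hC] := graph_norm_equiv.
(* Scaling by C turns a bound in n_0 into one in every n_c simultaneously. *)
exists (fun t => C * v t); split.
- by move=> a b /vm; rewrite ler_pM2l.
- move=> t e e0; have [d d0 hd] := vc t (e / C) (divr_gt0 e0 C0).
  exists d => // s /hd; rewrite ler_pdivlMr// -mulrBr normrM gtr0_norm// mulrC.
  by [].
- move=> a b c y aT bT cT Dy.
  have lt a' b' : 0 <= a' <= T -> 0 <= b' <= T -> a' < b' ->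
      rnorm (A b' y - A a' y) <= `|C * v b' - C * v a'| * graph_norm (A c) y.
    move=> aT' bT' ab; apply: le_trans (jump_le aT' bT' Dy) _.
    rewrite -mulrBr normrM gtr0_norm// (mulrC C) -mulrA.
    apply: ler_pM; rewrite ?jump_ge0 ?graph_norm_ge0//.
      case/andP: aT' => a0 _; case/andP: bT' => _ bT'.
      exact: le_trans (vj _ _ a0 ab bT') (ler_norm _).
    exact: hC.
  have [ab|ba|->] := ltgtP a b.
  + by rewrite rnormC distrC; exact: lt.
  + exact: lt.
  + by rewrite !subrr rnorm0 normr0 mul0r.
Qed.

End Hypotheses.

Theorem theorem2p1 (R : realType) (X : completeNormedModType R[i])
  (T omega : R) (D : set X) (A : R -> X -> X) (expA : R -> R -> X -> X)
  (hT : 0 < T)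
  (hX : uniformly_convex X)
  (hD : submod_closed [in D])
  (hgroup : forall t : R, t \in `[0, T] -> strongly_continuous_group (expA t))
  (hgen : forall t : R, t \in `[0, T] -> is_generator D (A t) (expA t))
  (hbound : forall t s : R, t \in `[0, T] ->
    (opnorm setT (@rnorm R X) (expA t s) <= (expR (omega * `|s|))%:E)%E)
  (hLYX : forall t : R, t \in `[0, T] ->
    bounded_operator D (graph_norm (A 0)) (A t))
  (hcont : opnorm_continuous D (graph_norm (A 0)) T A)
  (hbv : opnorm_bounded_variation D (graph_norm (A 0)) T A) :
  exists U : R -> R -> X -> X,
    evolution_system T D A U /\
    forall V : R -> R -> X -> X, evolution_system T D A V ->
      forall t s : R, t \in `[0, T] -> s \in `[0, T] -> V t s =1 U t s.
Proof.
have HG a : 0 <= a <= T -> qgroup `|omega| D (A a) (expA a) by exact: expA_qgroup.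
have [v [vm vc HV]] := control hT hX hgroup hgen hbound hLYX hcont hbv.
pose U := limU T expA.
have I t : (t \in `[0, T]) = (0 <= t <= T) by rewrite in_itv.
have rn0 : rnorm (0 : X) = 0 by exact: rnorm0.
exists U; split.
  split.
  - move=> t s; rewrite !I => tT sT.
    have Ul := limU_lin hT HG vm HV sT tT.
    split; first by move=> a x y _ _; exact: Ul.
    apply: le_lt_trans (ltry (expR (`|omega| * T))); apply: opnorm_bound => //.
    by move=> y _; exact: (limU_bound hT HG vm HV).
  - move=> y s Dy; rewrite I => sT x; split.
    + by move=> t; rewrite I => tT; exact: (limU_dom hT HG hX vm vc HV sT tT Dy).
    + apply/has_derivative_onP => t tT.
      exact (limU_solution hT HG hX vm vc HV sT Dy tT).
    + apply/subspace_continuousP => t; rewrite /= in_itv/= => tT.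
      apply/within_itv_cvgP => e e0.
      exact: (limU_gen_cont hT HG hX vm vc HV sT Dy tT e0).
    + exact: (limU_id hT HG vm HV).
  - by move=> s x; rewrite I; exact: (limU_id hT HG vm HV).
  - by move=> s r t x; rewrite !I; exact: (limU_comp hT HG vm HV).
  - move=> x; apply/subspace_continuousP => -[t0 s0] [] /=.
    rewrite !in_itv/= => t0T s0T; apply/rcvgP => e e0.
    have [d d0 hd] := limU_cont hT HG vm vc HV x t0T s0T e0.
    apply/nbhs_ballP; exists d => // -[t s] [/=]; rewrite /ball/= => tt ss [/=].
    by rewrite !in_itv/= => tT sT; apply: hd => //; rewrite distrC.
move=> V [Vb Vsol Vid Vcomp Vcont] t s; rewrite !I => tT sT x.
(* On D the difference of the two families solves the equation with datum 0; density of D and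
   boundedness then give equality on X. *)
have VD y : D y -> V t s y = U t s y.
  move=> Dy; apply/eqP; rewrite -subr_eq0; apply/eqP.
  have [VDy /has_derivative_onP Vd _ Vs] := Vsol y s Dy ltac:(by rewrite I).
  apply: (solution_unique HG (x := fun r => V r s y - U r s y) sT tT).
  - move=> r rT; apply: (domB (HG r rT)); first by apply: VDy; rewrite I.
    exact: (limU_dom hT HG hX vm vc HV sT rT Dy).
  - move=> r rT; rewrite (genB (HG r rT)); last 2 first.
    + by apply: VDy; rewrite I.
    + exact: (limU_dom hT HG hX vm vc HV sT rT Dy).
    apply: deriv_withinB; first exact: (Vd r rT).
    exact (limU_solution hT HG hX vm vc HV sT Dy rT).
  - by rewrite Vs /U (limU_id hT HG vm HV)// subrr.
have [Vl Vbd] := Vb t s ltac:(by rewrite I) ltac:(by rewrite I).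
have linV : lin (V t s) by move=> a y z; exact: Vl.
have linU := limU_lin hT HG vm HV sT tT.
(* The norm of [V t s] comes without a uniform rate; its value at this one pair (t, s) is enough for
   the density argument. *)
pose C := fine (opnorm setT (@rnorm R X) (V t s)).
have VC y : rnorm (V t s y) <= C * rnorm y.
  apply: (@opnorm_fine_le _ _ setT) => //.
    by move=> a z _; exact: rnormZ.
  by move=> a z _; rewrite (linZ linV).
have zT : 0 <= (0 : R) <= T by rewrite lexx ltW.
apply/eqP; rewrite -subr_eq0; apply/eqP/rnorm_eq0/eqP; rewrite eq_le rnorm_ge0 andbT.
apply/ler_addgt0Pr => e e0; rewrite add0r.
pose K := `|C| + expR (`|omega| * T); have K0 : 0 < K by rewrite ltr_wpDl ?expR_gt0.
have [y Dy hy] := qg_dense (HG 0 zT) x (divr_gt0 e0 K0).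
have -> : V t s x - U t s x = V t s (x - y) - U t s (x - y).
  by rewrite (linsub linV) (VD y Dy) /U (linsub linU); zmod.
apply: le_trans (ler_rnormB _ _) _.
apply: (@le_trans _ _ (K * rnorm (x - y))); last first.
  by rewrite rnormC mulrC -ler_pdivlMr.
rewrite mulrDl lerD//; last exact: (limU_bound hT HG vm HV).
by apply: le_trans (VC _) _; rewrite ler_wpM2r ?rnorm_ge0// ler_norm.
Qed.
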